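(* Let $b,\sigma$ be the coefficients of the McKean--Vlasov SDE $dX_t=b(t,X_t,\mu_t)\,dt+\sigma(t,X_t,\mu_t)\,dW_t$ on $[0,T]$, where $\mu_t$ is the law of $X_t$, satisfying Assumption (A) of the context and with $\Sigma=\sigma\sigma^\top$ positive definite. Consider the Onsager--Machlup action functional $$I(\phi)=\int_0^T\mathcal{OM}\bigl(t,\phi_t,\dot\phi_t,\delta_{\phi_t}\bigr)\,dt,$$ where $$\mathcal{OM}(t,x,v,\mu)=\frac12\Bigl[(v-\widetilde b)^\top\Sigma^{-1}(v-\widetilde b)+\operatorname{div}\widetilde b-\frac16R\Bigr]$$ with all coefficients evaluated at $(t,x,\mu)$, and assume that $\mathcal{L}=\mathcal{OM}$ satisfies the Regularity Assumptions (B) of the context. Let $\phi\in C^2([0,T];\mathbb{R}^d)$ be a critical point of $I$ with $\phi(0)=z_0$ and $\phi(T)=z_T$. Then, for $t\in[0,T]$, $\phi$ satisfies $$\begin{aligned}\ddot\phi_t=\;&\partial_t\widetilde b+\Sigma(\mathbf{D}\widetilde b)^\top\Sigma^{-1}\widetilde b+\Bigl[\mathbf{D}\widetilde b-\Sigma(\mathbf{D}\widetilde b)^\top\Sigma^{-1}\Bigr]\dot\phi_t\\&+\frac12\Sigma\Bigl[(\dot\phi_t-\widetilde b)^\top(\mathbf{D}\Sigma^{-1})(\dot\phi_t-\widetilde b)+\mathbf{D}(\operatorname{div}\widetilde b)-\frac16\mathbf{D}R\Bigr]\\&-\Sigma\Bigl(\partial_t\Sigma^{-1}+(\mathbf{D}\Sigma^{-1})\dot\phi_t\Bigr)(\dot\phi_t-\widetilde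 b),\end{aligned}$$ where every occurrence of $\widetilde b,\Sigma,\Sigma^{-1},R$ and their derivatives is evaluated at $(t,\phi_t,\delta_{\phi_t})$. In particular, when $d=1$ and $\sigma$ is constant, so that $\widetilde b=b$, $\Sigma=\sigma^2$ and $R=0$, the second-order differential equation satisfied by the critical point $\phi$ reduces to $$\ddot\phi_t=\partial_tb+b\,\mathbf{D}b+\frac{\sigma^2}{2}\mathbf{D}(\partial_xb),$$ or, equivalently, $$\ddot\phi_t=\partial_tb+b\,\partial_xb+b\,D_\mu b(t,\phi_t,\delta_{\phi_t})(\phi_t)+\frac{\sigma^2}{2}\partial_x^2b+\frac{\sigma^2}{2}D_\mu(\partial_xb)(t,\phi_t,\delta_{\phi_t})(\phi_t).$$
   Context: **Notation.** $|\cdot|$, $\langle\cdot,\cdot\rangle$ are the Euclidean norm and inner product, $\|A\|=\sqrt{\operatorname{tr}(AA^\top)}$. $\mathcal{P}_2(\mathbb{R}^d)$ is the set of probability measures on $\mathbb{R}^d$ with finite second moment, with the $L^2$-Wasserstein distance $W_2$; $\delta_x$ is the Dirac measure at $x$; $\vee$ denotes maximum. $W$ is an $m$-dimensional standard Wiener process. The coefficients $b:[0,T]\times\mathbb{R}^d\times\mathcal{P}_2(\mathbb{R}^d)\to\mathbb{R}^d$, $\sigma:[0,T]\times\mathbb{R}^d\times\mathcal{P}_2(\mathbb{R}^d)\to\mathbb{R}^{d\times m}$ are Borel measurable. $z_0,z_T\in\mathbb{R}^d$ are given. **Assumption (A).** There is a constant $\kappa\ge2$ such that: 1. For every $R>0$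 there is $L_R>0$ such that for all $t\in[0,T]$, all $|x|\vee|y|\le R$, and all $\mu$: $\langle x-y,b(t,x,\mu)-b(t,y,\mu)\rangle\vee\|\sigma(t,x,\mu)-\sigma(t,y,\mu)\|^2\le L_R|x-y|^2$. 2. There is $L>0$ such that for all $t,x,\mu_1,\mu_2$: $|b(t,x,\mu_1)-b(t,x,\mu_2)|^2+\|\sigma(t,x,\mu_1)-\sigma(t,x,\mu_2)\|^2\le L\,W_2^2(\mu_1,\mu_2)$. 3. For each $t$, $b(t,\cdot,\cdot)$ and $\sigma(t,\cdot,\cdot)$ are continuous on $\mathbb{R}^d\times\mathcal{P}_2(\mathbb{R}^d)$. 4. There is $K>0$ such that for all $t,x,\mu$: $\langle x,b(t,x,\mu)\rangle\vee\|\sigma(t,x,\mu)\|^2\le K(1+|x|^2+W_2^2(\mu,\delta_0))$. 5. There is $K_1>0$ such that for all $t,x,\mu$: $|b(t,x,\mu)|^2\le K_1(1+|x|^\kappa+W_2^\kappa(\mu,\delta_0))$. **Geometry.** $\Sigma=\sigma\sigma^\top$ with entries $\Sigma^{lj}$. The induced Riemannian metric on $\mathbb{R}^d$ is $g_{ij}=(\Sigma^{-1})_{ij}$, with inverse matrix $(g^{ij})$, Christoffel symbols $\Gamma^i_{lj}=\frac12\sum_r g^{ir}(\partial_{x^j}g_{lr}+\partial_{x^l}g_{jr}-\partial_{x^r}g_{lj})$, and scalar curvature $R$. The modified drift is $\widetilde b^{\,i}=b^i-\frac12\sum_{l,j}\Sigma^{lj}\Gamma^i_{lj}$, and $\operatorname{div}\widetilde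 b=\frac{1}{\sqrt{\det(\Sigma^{-1})}}\sum_i\partial_{x^i}\bigl(\widetilde b^{\,i}\sqrt{\det(\Sigma^{-1})}\bigr)$. All derivatives $\partial_{x^i}$ are in the state variable with $t$ and the measure argument held fixed, so that $\widetilde b,\operatorname{div}\widetilde b,R$ are functions of $(t,x,\mu)$. **$L$-derivative.** $h:\mathcal{P}_2(\mathbb{R}^d)\to\mathbb{R}$ is $L$-differentiable at $\mu$ if $L^2_\mu(\mathbb{R}^d;\mathbb{R}^d)\ni\psi\mapsto h(\mu\circ(\mathrm{Id}+\psi)^{-1})$ is Fréchet differentiable at $\psi=0$, i.e. there is a unique $\xi\in L^2_\mu(\mathbb{R}^d;\mathbb{R}^d)$ with $$\lim_{\mu(|\psi|^2)\to0}\frac{h(\mu\circ(\mathrm{Id}+\psi)^{-1})-h(\mu)-\mu(\langle\xi,\psi\rangle)}{\sqrt{\mu(|\psi|^2)}}=0;$$ then $D_\mu h(\mu):=\xi$. For $\mu=\delta_z$, the element $D_\mu h(\delta_z)(\cdot)\in L^2_{\delta_z}(\mathbb{R}^d;\mathbb{R}^d)$ is identified with its value $D_\mu h(\delta_z)(z)\in\mathbb{R}^d$. **Operator $\mathbf{D}$.** For a scalar coefficient $f(t,x,\mu)$, along Dirac measures, $\mathbf{D}_if(t,x,\delta_z):=\frac{\partial f}{\partial x_i}(t,x,\delta_z)+[D_\mu f(t,x,\delta_z)(z)]_i$, $i=1,\dots,d$. It is applied componentwise to vector- and matrix-valued coefficients: for a vector field $g$, $(\mathbf{D}g)_{ki}=\mathbf{D}_ig_k$;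 for a matrix $M$, $\mathbf{D}M$ is the third-order tensor whose $i$-th slice is $\mathbf{D}_iM$. Thus for $F\in\mathbb{R}^d$, $F^\top(\mathbf{D}M)F$ is the vector with $i$-th component $F^\top(\mathbf{D}_iM)F$; $(\mathbf{D}M)\dot\phi_t=\sum_i\dot\phi_t^i\,\mathbf{D}_iM$ is a matrix; and for scalar $f$, $\mathbf{D}f$ is the vector $(\mathbf{D}_if)_i$. **Regularity Assumptions (B)** on $\mathcal{L}:[0,T]\times\mathbb{R}^d\times\mathbb{R}^d\times\mathcal{P}_2(\mathbb{R}^d)\to\mathbb{R}$, $(t,x,v,\mu)\mapsto\mathcal{L}(t,x,v,\mu)$: $\mathcal{L}$ is continuously differentiable in $x$ and $v$, and $L$-differentiable in $\mu$ at every Dirac measure; and the maps $(t,x,v,z)\mapsto\frac{\partial\mathcal{L}}{\partial x}(t,x,v,\delta_z)$, $(t,x,v,z)\mapsto\frac{\partial\mathcal{L}}{\partial v}(t,x,v,\delta_z)$ and $(t,x,v,z)\mapsto D_\mu\mathcal{L}(t,x,v,\delta_z)(z)$ are continuous on $[0,T]\times\mathbb{R}^d\times\mathbb{R}^d\times\mathbb{R}^d$. **Critical point.** $\phi$ is a critical point of $I$ (with fixed endpoints) if $\frac{d}{d\varepsilon}I(\phi+\varepsilon\eta)\big|_{\varepsilon=0}=0$ for all $\eta\in C_c^\infty((0,T);\mathbb{R}^d)$.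
   Formalization: The general equation is stated assuming that ∂_t b̃, ∂_tΣ⁻¹, D(div b̃) and DR exist at (t,φ_t,δ_{φ_t}) for t in [0,T]; (A) and (B) do not ensure this (e.g. d=1, b=0, σ=2+|t−T/2|, φ=0). Critical point includes integrability of the action's integrand near ε=0. *)

(* Defs.v *)
From HB Require Import structures.
From mathcomp Require Import all_boot all_order all_algebra.
From mathcomp Require Import all_classical all_reals all_analysis measurable_realfun.

Set Implicit Arguments.
Unset Strict Implicit.
Unset Printing Implicit Defensive.

Import Order.TTheory GRing.Theory Num.Theory.
Import numFieldNormedType.Exports.

Local Open Scope classical_set_scope.
Local Open Scope ring_scope.

(* The library norm on matrices is the sup norm, so the Euclidean quantities
   are defined here; vectors of R^d are columns. *)
Section euclidean.
Variable R : realType.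

Definition dot d (x y : 'cV[R]_d) : R := (x^T *m y) ord0 ord0.
Definition sqnorm d (x : 'cV[R]_d) : R := dot x x.
Definition enorm d (x : 'cV[R]_d) : R := Num.sqrt (sqnorm x).
Definition sqfrob d m (A : 'M[R]_(d, m)) : R := \tr (A *m A^T).
Definition qform d (A : 'M[R]_d) (x : 'cV[R]_d) : R :=
  (x^T *m A *m x) ord0 ord0.

End euclidean.

HB.instance Definition _ (X Y : ptopologicalType) := Pointed.on (X * Y)%type.

Definition borel (X : ptopologicalType) := g_sigma_algebraType (@open X).

Section wasserstein.
Variables (R : realType) (d : nat).
Local Notation V := 'cV[R]_d.
Local Notation BV := (borel V).

Definition second_moment (mu : probability BV R) : \bar R :=
  (\int[mu]_x (sqnorm (x : V))%:E)%E.

Record P2 := MkP2 {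
  P2val :> probability BV R ;
  P2_second_moment : (second_moment P2val < +oo)%E }.

(* pi ranges over the couplings of mu and nu *)
Definition W2sq (mu nu : P2) : \bar R :=
  ereal_inf [set c | exists pi : probability (BV * BV)%type R,
    [/\ forall A : set BV, measurable A -> pi (A `*` setT) = mu A,
        forall A : set BV, measurable A -> pi (setT `*` A) = nu A &
        c = (\int[pi]_p (sqnorm ((p.1 : V) - (p.2 : V)))%:E)%E]].

Definition W2 (mu nu : P2) : R := Num.sqrt (fine (W2sq mu nu)).

Lemma measurable_entry (i : 'I_d) :
  measurable_fun (setT : set BV) (fun x : BV => (x : V) i ord0).
Proof.
apply: (measurability _ (measurable_realfun.RGenOpens.measurableE R)) => _ [_ [a [c ->]] <-].
rewrite setTI; apply: sub_sigma_algebra.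
apply: open_comp; last exact: interval_open.
by move=> x _; exact: coord_continuous.
Qed.

Lemma measurable_sqnorm :
  measurable_fun (setT : set BV) (fun x : BV => sqnorm (x : V)).
Proof.
have -> : (fun x : BV => sqnorm (x : V)) =
    (fun x : BV => \sum_(i < d) ((x : V) i ord0 * (x : V) i ord0)).
  by apply/funext => x; rewrite /sqnorm /dot mxE; apply: eq_bigr => i _;
    rewrite mxE.
apply: measurable_sum => i.
by apply: measurable_funM; exact: measurable_entry.
Qed.

Lemma second_moment_dirac (z : V) : (second_moment (@dirac _ BV z R) < +oo)%E.
Proof.
rewrite /second_moment integral_dirac//; last first.
  by apply/measurable_EFinP; exact: measurable_sqnorm.
by rewrite diracT mul1e ltry.
Qed.

Definition dirac2 (z : V) : P2 := MkP2 (second_moment_dirac z).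

(* the topology of the Wasserstein distance *)
Definition W2_open (U : set P2) : Prop :=
  forall mu, U mu -> exists2 r : R, 0 < r & forall nu, W2 mu nu < r -> U nu.

Lemma W2_openT : W2_open setT.
Proof. by move=> mu _; exists 1. Qed.

Lemma W2_openI : setI_closed W2_open.
Proof.
move=> A B oA oB mu [/oA[r r0 Ar] /oB[s s0 Bs]].
by exists (Num.min r s) => [|nu]; rewrite lt_min ?r0// => /andP[/Ar ? /Bs ?].
Qed.

Lemma W2_open_bigU (I : Type) (f : I -> set P2) :
  (forall i, W2_open (f i)) -> W2_open (\bigcup_i f i).
Proof.
by move=> of_ mu [i _ /of_[r r0 fr]]; exists r => // nu /fr ?; exists i.
Qed.

HB.instance Definition _ := gen_eqMixin P2.
HB.instance Definition _ := gen_choiceMixin P2.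
HB.instance Definition _ := isPointed.Build P2 (dirac2 0).
HB.instance Definition _ :=
  isOpenTopological.Build P2 W2_openT W2_openI W2_open_bigU.

End wasserstein.

Section Lderivative.
Variables (R : realType) (d : nat).
Local Notation V := 'cV[R]_d.
Local Notation BV := (borel V).
Local Notation P2 := (P2 R d).

Definition sq_integrable (mu : P2) (psi : V -> V) : Prop :=
  measurable_fun (setT : set BV) (psi : BV -> BV) /\
  (\int[mu]_x (sqnorm (psi x))%:E < +oo)%E.

Definition L2norm (mu : P2) (psi : V -> V) : R :=
  Num.sqrt (\int[mu]_x sqnorm (psi x)).

(* nu = mu o (Id + psi)^-1 *)
Definition is_shift (mu : P2) (psi : V -> V) (nu : P2) : Prop :=
  forall A : set BV, measurable A ->
    nu A = pushforward mu (fun x : BV => (x : V) + psi x : BV) A.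

Definition is_Lderive (h : P2 -> R) (mu : P2) (xi : V -> V) : Prop :=
  sq_integrable mu xi /\
  forall e : R, 0 < e -> exists2 r : R, 0 < r &
    forall (psi : V -> V) (nu : P2),
      sq_integrable mu psi -> is_shift mu psi nu -> L2norm mu psi < r ->
      `|h nu - h mu - \int[mu]_x dot (xi x) (psi x)| <= e * L2norm mu psi.

Definition Ldifferentiable (h : P2 -> R) (mu : P2) : Prop :=
  exists xi, is_Lderive h mu xi.

(* D_mu h(delta_z)(z): an element of L^2(delta_z) is determined by its value
   at z, so the choice is unique when h is L-differentiable at delta_z. *)
Definition Lderive (h : P2 -> R) (z : V) : V :=
  xget 0 [set v | exists xi, is_Lderive h (dirac2 z) xi /\ v = xi z].

End Lderivative.

Section space_derivatives.
Variables (R : realType) (d : nat).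
Local Notation V := 'cV[R]_d.
Local Notation P2 := (P2 R d).

Definition partial (i : 'I_d) (f : V -> R) (x : V) : R :=
  'D_(delta_mx i ord0) f x.

Definition grad (f : V -> R) (x : V) : V := \col_i partial i f x.

Definition C1 (f : V -> R) : Prop :=
  (forall x, differentiable f x) /\ continuous (grad f).

(* The operator D at (z, delta_z), for a coefficient with t held fixed. *)
Definition opD (f : V -> P2 -> R) (z : V) : V :=
  grad (f ^~ (dirac2 z)) z + Lderive (f z) z.

Definition opD_defined (f : V -> P2 -> R) (z : V) : Prop :=
  (forall i, derivable (f ^~ (dirac2 z)) z (delta_mx i ord0)) /\
  Ldifferentiable (f z) (dirac2 z).

End space_derivatives.

(* Derivatives in t of functions that only matter on [0, T]: one-sided at the
   two endpoints. *)
Section time_derivatives.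
Variables (R : realType) (T : R).

Definition diff_quot (f : R -> R) (t s : R) : R := (f s - f t) / (s - t).

Definition tderivable (f : R -> R) (t : R) : Prop :=
  cvg (diff_quot f t s @[s --> within `[0, T] t^']).

Definition tderive (f : R -> R) (t : R) : R :=
  lim (diff_quot f t s @[s --> within `[0, T] t^']).

Definition tC1 (f : R -> R) : Prop :=
  (forall t, t \in `[0, T] -> tderivable f t) /\
  {within `[0, T], continuous (tderive f)}.

Definition mtderive p q (F : R -> 'M[R]_(p, q)) (t : R) : 'M[R]_(p, q) :=
  \matrix_(i, j) tderive (fun s => F s i j) t.

Definition mtderivable p q (F : R -> 'M[R]_(p, q)) (t : R) : Prop :=
  forall i j, tderivable (fun s => F s i j) t.

Definition C2_path d (phi : R -> 'cV[R]_d) : Prop :=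
  forall i, tC1 (fun t => phi t i ord0) /\
            tC1 (fun t => mtderive phi t i ord0).

(* C_c^oo((0, T); R^d) *)
Definition test_path d (eta : R -> 'cV[R]_d) : Prop :=
  (forall i n t, derivable (derive1n n (fun s => eta s i ord0)) t 1) /\
  exists a c : R, [/\ 0 < a, c < T & forall t, t \notin `[a, c] -> eta t = 0].

End time_derivatives.

Section riemannian.
Variables (R : realType) (d : nat) (g : 'cV[R]_d -> 'M[R]_d).
Local Notation V := 'cV[R]_d.

(* Gamma^i_{lj} *)
Definition christoffel (i l j : 'I_d) (x : V) : R :=
  2^-1 * \sum_(r < d) invmx (g x) i r *
    (partial j (fun y => g y l r) x + partial l (fun y => g y j r) x
     - partial r (fun y => g y l j) x).

(* Ric_{lj} = d_i Gamma^i_{lj} - d_j Gamma^i_{il}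
              + Gamma^i_{ir} Gamma^r_{lj} - Gamma^i_{jr} Gamma^r_{il},
   for which round spheres have positive curvature *)
Definition ricci (l j : 'I_d) (x : V) : R :=
  \sum_(i < d) (partial i (christoffel i l j) x
                - partial j (christoffel i i l) x
    + \sum_(r < d) (christoffel i i r x * christoffel r l j x
                    - christoffel i j r x * christoffel r i l x)).

Definition scalar_curvature (x : V) : R :=
  \sum_(l < d) \sum_(j < d) invmx (g x) l j * ricci l j x.

Definition divergence (F : V -> V) (x : V) : R :=
  (Num.sqrt (\det (g x)))^-1 *
  \sum_(i < d) partial i (fun y => F y i ord0 * Num.sqrt (\det (g y))) x.

End riemannian.

Section assumptions.
Variables (R : realType) (T : R) (d m : nat).
Local Notation V := 'cV[R]_d.
Local Notation P2 := (P2 R d).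
Variables (b : R -> V -> P2 -> V) (sigma : R -> V -> P2 -> 'M[R]_(d, m)).

(* Borel measurability on [0, T] x R^d x P_2(R^d) *)
Definition borel_coefficient (X : ptopologicalType) (f : R -> V -> P2 -> X) :=
  measurable_fun
    ([set p | p.1.1 \in `[0, T]] : set (borel (R * V * P2)%type))
    ((fun p => f p.1.1 p.1.2 p.2) : borel (R * V * P2)%type -> borel X).

Record assumption_A : Prop := {
  A_borel_b : borel_coefficient b ;
  A_borel_sigma : borel_coefficient sigma ;
  A_local_monotone : forall r : R, 0 < r -> exists2 L : R, 0 < L &
    forall t x y mu, t \in `[0, T] -> Num.max (enorm x) (enorm y) <= r ->
      Num.max (dot (x - y) (b t x mu - b t y mu))
              (sqfrob (sigma t x mu - sigma t y mu)) <= L * sqnorm (x - y) ;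
  A_lipschitz_measure : exists2 L : R, 0 < L &
    forall t x mu1 mu2, t \in `[0, T] ->
      sqnorm (b t x mu1 - b t x mu2) + sqfrob (sigma t x mu1 - sigma t x mu2)
        <= L * W2 mu1 mu2 ^+ 2 ;
  A_continuous : forall t, t \in `[0, T] ->
    continuous (fun p : V * P2 => b t p.1 p.2) /\
    continuous (fun p : V * P2 => sigma t p.1 p.2) ;
  A_growth : exists2 K : R, 0 < K &
    forall t x mu, t \in `[0, T] ->
      Num.max (dot x (b t x mu)) (sqfrob (sigma t x mu))
        <= K * (1 + sqnorm x + W2 mu (dirac2 0) ^+ 2) ;
  A_growth_drift : exists2 kappa : R, 2 <= kappa & exists2 K1 : R, 0 < K1 &
    forall t x mu, t \in `[0, T] ->
      sqnorm (b t x mu)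
        <= K1 * (1 + enorm x `^ kappa + W2 mu (dirac2 0) `^ kappa) }.

Definition Sigma t x mu : 'M[R]_d := sigma t x mu *m (sigma t x mu)^T.

Definition Sigma_posdef : Prop :=
  forall t x mu, t \in `[0, T] ->
    forall w : V, w != 0 -> 0 < qform (Sigma t x mu) w.

Definition iSigma t x mu : 'M[R]_d := invmx (Sigma t x mu).

Definition btilde t x mu : V :=
  \col_i (b t x mu i ord0 - 2^-1 * \sum_(l < d) \sum_(j < d)
    Sigma t x mu l j * christoffel (fun y => iSigma t y mu) i l j x).

Definition div_btilde t x mu : R :=
  divergence (fun y => iSigma t y mu) (fun y => btilde t y mu) x.

Definition Rscal t x mu : R := scalar_curvature (fun y => iSigma t y mu) x.

Definition OM t x (v : V) mu : R :=
  2^-1 * (qform (iSigma t x mu) (v - btilde t x mu)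
          + div_btilde t x mu - 6^-1 * Rscal t x mu).

End assumptions.

Section functional.
Variables (R : realType) (T : R) (d : nat).
Local Notation V := 'cV[R]_d.
Local Notation P2 := (P2 R d).
Variable L : R -> V -> V -> P2 -> R.

Record regularity_B : Prop := {
  B_C1_x : forall t v mu, t \in `[0, T] -> C1 (fun x => L t x v mu) ;
  B_C1_v : forall t x mu, t \in `[0, T] -> C1 (fun v => L t x v mu) ;
  B_Ldiff : forall t x v z, t \in `[0, T] ->
    Ldifferentiable (L t x v) (dirac2 z) ;
  (* q = (t, x, v, z) *)
  B_cont_x : {within [set q : R * V * V * V | q.1.1.1 \in `[0, T]],
    continuous (fun q =>
      grad (fun x => L q.1.1.1 x q.1.2 (dirac2 q.2)) q.1.1.2)} ;
  B_cont_v : {within [set q : R * V * V * V | q.1.1.1 \in `[0, T]],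
    continuous (fun q =>
      grad (fun v => L q.1.1.1 q.1.1.2 v (dirac2 q.2)) q.1.2)} ;
  B_cont_mu : {within [set q : R * V * V * V | q.1.1.1 \in `[0, T]],
    continuous (fun q => Lderive (L q.1.1.1 q.1.1.2 q.1.2) q.2)} }.

Definition along (phi : R -> V) (t : R) : R :=
  L t (phi t) (mtderive T phi t) (dirac2 (phi t)).

Definition action (phi : R -> V) : R :=
  \int[@lebesgue_measure R]_(t in `[0, T]) along phi t.

(* The integral of a non-integrable function has a default value, hence the
   requirement that the action be a convergent integral near phi. *)
Definition critical_point (phi : R -> V) : Prop :=
  forall eta, test_path T eta ->
    (\forall e \near (0 : R), (@lebesgue_measure R).-integrable `[0, T]
       (EFin \o along (fun t => phi t + e *: eta t))) /\
    is_derive (0 : R) 1 (fun e => action (fun t => phi t + e *: eta t)) 0.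

End functional.

Section equation.
Variables (R : realType) (T : R) (d m : nat).
Local Notation V := 'cV[R]_d.
Local Notation P2 := (P2 R d).
Variables (b : R -> V -> P2 -> V) (sigma : R -> V -> P2 -> 'M[R]_(d, m)).

(* (D btilde)_{ki} = D_i btilde_k *)
Definition D_btilde t z : 'M[R]_d :=
  \matrix_(k, i) opD (fun x mu => btilde b sigma t x mu k ord0) z i ord0.

(* the i-th slice D_i Sigma^-1 *)
Definition D_iSigma t z (i : 'I_d) : 'M[R]_d :=
  \matrix_(k, l) opD (fun x mu => iSigma sigma t x mu k l) z i ord0.

(* What regularity_B, which only sees the coefficients through OM, leaves out for
   the right-hand side to make sense at (t, z, delta_z): the derivatives in t,
   and D of div btilde and of the curvature taken separately. *)
Definition rhs_defined t z : Prop :=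
  [/\ mtderivable T (fun s => btilde b sigma s z (dirac2 z)) t,
      mtderivable T (fun s => iSigma sigma s z (dirac2 z)) t,
      opD_defined (div_btilde b sigma t) z &
      opD_defined (Rscal sigma t) z].

Definition EL_rhs t z v : V :=
  let mu := dirac2 z in
  let bt := btilde b sigma t z mu in
  let S := Sigma sigma t z mu in
  let iS := iSigma sigma t z mu in
  let Db := D_btilde t z in
  let DiS := D_iSigma t z in
  mtderive T (fun s => btilde b sigma s z mu) t
  + S *m Db^T *m iS *m bt
  + (Db - S *m Db^T *m iS) *m v
  + 2^-1 *: (S *m (\col_i qform (DiS i) (v - bt)
                   + opD (div_btilde b sigma t) z
                   - 6^-1 *: opD (Rscal sigma t) z))
  - S *m (mtderive T (fun s => iSigma sigma s z mu) t
          + \sum_(i < d) v i ord0 *: DiS i) *m (v - bt).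

End equation.

(* Main.v *)
Require Import Defs.
From HB Require Import structures.
From mathcomp Require Import all_boot all_order all_algebra.
From mathcomp Require Import all_classical all_reals all_analysis measurable_realfun.
From mathcomp Require Import ring lra.

Set Implicit Arguments.
Unset Strict Implicit.
Unset Printing Implicit Defensive.

Import Order.TTheory GRing.Theory Num.Theory.
Import numFieldNormedType.Exports.

Local Open Scope classical_set_scope.
Local Open Scope ring_scope.

(** The equation is the Euler-Lagrange equation of the Lagrangian
    L(t, x, v, mu) = OM(t, x, v, mu) restricted to mu = delta_x, solved for the
    acceleration.  Along Dirac masses the measure argument becomes an ordinary
    variable: a shift of delta_z is delta_(z + w), so the L-derivative of h at
    delta_z is the gradient of w |-> h(delta_(z + w)) at 0, and opD f z is the
    sum of the two partial gradients of (x, y) |-> f x delta_y at (z, z).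

    First variation.  Perturbing phi by h * theta in one coordinate, the mean
    value theorem in each of the arguments x, v and z, and the joint
    continuity of the three gradients on the compact [0, T], give a first-order
    expansion of L that is uniform in t (uniform_expansion).  Hence the
    derivative of the action is the integral of q theta + p theta', where
    p = d_v L is the momentum and q = (d_x + d_mu) L is the force
    (weak_euler_lagrange).  The lemma du_bois_reymond then shows that p is a
    primitive of q, on the closed interval [0, T]: its test functions are
    differences of two narrow smooth steps, so that theta' is the difference of
    two spikes and p - int q takes equal averages near any two points.

    Coefficients.  The regularity assumption only speaks of OM, but OM is
    quadratic in v, so Sigma^-1 and Sigma^-1 btilde are linear combinations of
    the functions OM(., v, .) for fixed v (iSigma_polarization,
    iSigma_btilde_polarization) and inherit their derivatives.  The field
    btilde itself solves the linear system whose matrix is Sigma^-1 and whose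
    right-hand side is Sigma^-1 btilde; it is differentiable because Sigma is
    continuous (opD_defined_solve).

    Expansion.  The momentum is p = Sigma^-1 phi' - Sigma^-1 btilde.  Along the
    path the variation of its coefficients splits into the variation in t at
    the frozen point, and the variation in (x, mu) given by the chain rule
    path_increment.  Equating p' with q and multiplying by Sigma gives the
    equation (critical_path_equation).

    When d = 1 and sigma is constant the metric is flat, and the derivative in
    t of b exists by itself: the Euler-Lagrange equation makes the momentum
    differentiable, and the momentum is an affine function of phi' and b. *)

(** * A flat bump function *)
Section bump.
Variable R : realType.
Implicit Types (P : {poly R}) (n : nat) (x y : R).

Let w x : R := x * (1 - x).

(** The functions P / w^n * exp (-1/w) on 0 < w with w = x (1 - x), extended by
    0.  The family is closed under derivation, which makes each member smooth,
    and all members vanish outside ]0, 1[. *)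
Definition flat P n x : R :=
  if 0 < w x then P.[x] * ((w x)^-1 ^+ n * expR (- (w x)^-1)) else 0.

(** Numerator of the derivative, over the denominator w^(n + 2). *)
Definition flat_deriv P n : {poly R} :=
  let W := 'X * (1 - 'X) : {poly R} in
  deriv P * W ^+ 2 - n%:R *: (P * deriv W * W) + P * deriv W.

(** The exponential series bounds exp (1/u) below by (1/u)^(n + 2) / (n + 2)!. *)
Lemma invX_expRN_le n (u : R) : 0 < u ->
  u^-1 ^+ n * expR (- u^-1) <= (n.+2)`!%:R * u ^+ 2.
Proof.
move=> u0; have v0 : 0 < u^-1 by rewrite invr_gt0.
have := expR_ge1Dxn n.+1 (ltW v0).
have F0 : (0 : R) < (n.+2)`!%:R by rewrite ltr0n fact_gt0.
move=> H; rewrite expRN ler_pdivrMr ?expR_gt0//.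
have {H}: u^-1 ^+ n.+2 / (n.+2)`!%:R <= expR u^-1 by lra.
rewrite ler_pdivrMr// => H.
have u2 : 0 < u ^+ 2 by rewrite exprn_gt0.
apply: (@le_trans _ _ (u ^+ 2 * u^-1 ^+ n.+2)).
  by rewrite -[n.+2]addn2 exprD mulrCA -exprMn mulfV ?gt_eqF// expr1n mulr1.
by rewrite [leRHS]mulrAC [leRHS]mulrC ler_pM2l// mulrC.
Qed.

Lemma is_derive_flat_quadratic (f : R -> R) (K x : R) :
  f x = 0 -> (\forall y \near x, `|f y| <= K * (y - x) ^+ 2) ->
  is_derive x 1 f 0.
Proof.
move=> fx0 fK.
have cv : h^-1 *: (f (h *: 1 + x) - f x) @[h --> (0:R)^'] --> (0 : R).
  apply/cvgr0Pnorm_le => e e0.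
  have fK0 : \forall h \near (0:R), `|f (h + x)| <= K * h ^+ 2.
    by move: fK; rewrite (near_shift 0) subr0; apply: filterS => h /=; rewrite addrK.
  have K1 : 0 < `|K| + 1 by apply: ltr_wpDl.
  near=> h.
  have h0 : h != 0 by near: h; exact: nbhs_dnbhs_neq.
  rewrite fx0 subr0 /= [h *: _]mulr1 normrM normfV ler_pdivrMl ?normr_gt0//.
  have H1 : `|f (h + x)| <= K * h ^+ 2.
    by near: h; apply: nbhs_dnbhs; exact: fK0.
  have H2 : `|h| <= e / (`|K| + 1).
    near: h; apply: dnbhs0_le; exact: divr_gt0.
  apply: (le_trans H1); rewrite -real_normK ?num_real// expr2 mulrCA ler_wpM2l//.
  move: H2; rewrite ler_pdivlMr//; apply: le_trans.
  rewrite mulrC ler_wpM2l// -[leLHS]addr0 lerD//; exact: ler_norm.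
apply: DeriveDef; first by apply/cvg_ex; exists 0.
exact/cvg_lim.
Unshelve. all: by end_near. Qed.

Lemma is_derive_w x : is_derive x (1:R) w (1 - x *+ 2).
Proof.
rewrite (_ : w = horner ('X * (1 - 'X))); last first.
  by apply/funext => y; rewrite !hornerE.
apply: (is_derive_eq (is_derive_poly _ _)).
by rewrite !poly.derivE !hornerE; ring.
Qed.

Lemma continuous_w : continuous w.
Proof.
move=> x; have [d _] := is_derive_w x.
by apply: differentiable_continuous; apply/derivable1_diffP.
Qed.

Lemma near_poly_bounded P x : exists2 M : R, 0 <= M & \forall y \near x, `|P.[y]| <= M.
Proof.
exists (`|P.[x]| + 1); first exact: addr_ge0.
have /cvgrPdist_le/(_ 1 ltr01) : P.[y] @[y --> x] --> P.[x].
  exact: continuous_horner.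
apply: filterS => y H.
by rewrite -[P.[y]](subKr P.[x]) (le_trans (ler_normB _ _))// lerD2l.
Qed.

Lemma horner_flat_deriv P n x : (flat_deriv P n).[x] =
  P^`().[x] * w x ^+ 2 - n%:R * (P.[x] * (1 - x *+ 2) * w x) + P.[x] * (1 - x *+ 2).
Proof. by rewrite /flat_deriv !poly.derivE expr2 !(hornerD, hornerN, hornerM, hornerZ, hornerX, hornerC) /w; ring. Qed.

(** Where w x <= 0 the function is O((y - x)^2) near x: if w y > 0 then
    w y <= w y - w x = (y - x) (1 - y - x), and the function is O(w^2). *)
Lemma is_derive_flat P n x : is_derive x (1:R) (flat P n) (flat (flat_deriv P n) n.+2 x).
Proof.
rewrite {2}/flat; case: ifPn => [wx|]; last first.
- rewrite -leNgt => wx.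
  have [M M0 PM] := near_poly_bounded P x.
  have [N N0 QN] := near_poly_bounded (1 - 'X - x%:P) x.
  apply: (@is_derive_flat_quadratic _ (M * ((n.+2)`!%:R * N ^+ 2))).
    by rewrite /flat ltNge wx.
  near=> y.
  have Py : `|P.[y]| <= M by near: y.
  have Qy : `|(1 - 'X - x%:P).[y]| <= N by near: y.
  rewrite /flat; case: ifPn => [wy|_]; last first.
    by rewrite normr0 mulr_ge0 ?sqr_ge0// mulr_ge0// mulr_ge0 ?ler0n ?sqr_ge0.
  rewrite normrM -(mulrA M) ler_pM// ger0_norm; last first.
    by rewrite mulr_ge0 ?expR_ge0// exprn_ge0// invr_ge0 ltW.
  apply: (le_trans (invX_expRN_le n wy)).
  rewrite -mulrA ler_wpM2l// -exprMn -[leRHS]real_normK ?num_real//.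
  rewrite lerXn2r ?nnegrE//; first exact: ltW.
  rewrite normrM (ger0_norm N0).
  have -> : w y = w y - w x + w x by rewrite subrK.
  apply: (@le_trans _ _ (w y - w x)); first by rewrite gerDl.
  apply: (le_trans (ler_norm _)).
  rewrite (_ : w y - w x = (y - x) * (1 - 'X - x%:P).[y]); last first.
    by rewrite /w !hornerE; ring.
  by rewrite normrM mulrC ler_wpM2r.
- have W0 : w x != 0 by rewrite gt_eqF.
  have near0 : \forall y \near x, 0 < w y.
    by have := @continuous_w x; move/cvgr_gt; apply.
  pose g := fun y => P.[y] * ((w y)^-1 ^+ n * expR (- (w y)^-1)).
  apply: (@near_eq_is_derive _ _ _ g).
    by apply: filterS near0 => y wy; rewrite /flat wy.
  have dw := is_derive_w x.
  have dV : is_derive x (1:R) (fun y => (w y)^-1) (- (w x)^-2 *: (1 - x *+ 2)).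
    exact: is_deriveV.
  have dE : is_derive x (1:R) (fun y => expR (- (w y)^-1))
      (expR (- (w x)^-1) * - (- (w x)^-2 *: (1 - x *+ 2))).
    have := @is_derive1_comp _ expR (fun y => - (w y)^-1) x _ _ (is_derive_expR _)
       (is_deriveN dV).
    exact.
  have dn := is_deriveX n dV.
  have dP := is_derive_poly P x.
  have H := is_deriveM dP (is_deriveM dn dE).
  have -> : g = horner P * ((fun y => (w y)^-1) ^+ n * (fun y => expR (- (w y)^-1))).
    by apply/funext => y; rewrite /g !fctE.
  apply: (is_derive_eq H).
  rewrite horner_flat_deriv !fctE /GRing.scale /= -!exprVn.
  case: n {H g dn} => [|n]; rewrite ?mulr0n ?mul0r.
    by rewrite !expr0 !expr2; field.
  rewrite -[n.+1.-1]/n; move: (expR _) => E.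
  have -> k : (w x)^-1 ^+ k.+3 = (w x)^-1 ^+ k * ((w x)^-1 * (w x)^-1 * (w x)^-1).
    by rewrite -addn3 exprD !exprS expr0 mulr1 !mulrA.
  rewrite [_ ^+ n.+1]exprS; move: (_ ^+ n) => U.
  by field.
Unshelve. all: by end_near. Qed.
End bump.

(** * Smooth steps *)
Section smooth.
Variable R : realType.
Implicit Types (f F : R -> R).

Definition smooth f := forall n x, derivable (derive1n n f) x 1.

(** Smoothness by invariance: it is enough to exhibit a set of derivable
    functions that is stable under derivation. *)
Lemma smooth_class (A : set (R -> R)) :
  (forall f, A f -> (forall x, derivable f x 1) /\ A f^`()%classic) ->
  forall f, A f -> smooth f.
Proof.
move=> AA f Af; have An n : A (derive1n n f).
  by elim: n => [|n IH]; rewrite ?derive1n0 ?derive1nS//; exact: (AA _ IH).2.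
by move=> n; exact: (AA _ (An n)).1.
Qed.

Lemma smooth_derive1 f : smooth f -> smooth f^`()%classic.
Proof. by move=> sf n x; have := sf n.+1 x; rewrite derive1Sn. Qed.

Lemma smooth_derivable f x : smooth f -> derivable f x 1.
Proof. by move=> sf; have := sf 0%N x; rewrite derive1n0. Qed.

Lemma derivable_continuous f : (forall x, derivable f x 1) -> continuous f.
Proof.
by move=> df x; apply/differentiable_continuous/derivable1_diffP; exact: df.
Qed.

Lemma is_derive_continuous f x d : is_derive x (1 : R) f d -> {for x, continuous f}.
Proof.
by move=> [df _]; apply/differentiable_continuous/derivable1_diffP; exact: df.
Qed.

Lemma is_derive_derive1 f x d : is_derive x (1 : R) f d -> f^`()%classic x = d.
Proof. by move=> H; rewrite derive1E; exact: derive_val. Qed.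

Lemma smooth_is_derive f x : smooth f -> is_derive x (1 : R) f (f^`()%classic x).
Proof. by move=> sf; rewrite derive1E; apply/derivableP/smooth_derivable. Qed.

Lemma is_derive_affine f (k a e x d : R) : is_derive ((x - a) / e) (1 : R) f d ->
  is_derive x (1 : R) (fun y => k * f ((y - a) / e)) (k * (e^-1 * d)).
Proof.
move=> H.
have H1 : is_derive x (1 : R) (fun y => (y - a) / e) e^-1.
  have := is_deriveM (is_deriveB (is_derive_id x (1:R)) (is_derive_cst a x (1 : R)))
   (is_derive_cst e^-1 x (1 : R)).
  by move=> D; apply: (is_derive_eq D); rewrite scaler0 add0r subr0; exact: mulr1.
have := is_deriveZ k (@is_derive1_comp _ f (fun y => (y - a) / e) x _ _ H H1).
by move=> D; apply: (is_derive_eq D); rewrite (mulrC d).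
Qed.

Lemma smooth_affine_difference F (k a c e : R) : smooth F ->
  smooth (fun x => k * F ((x - a) / e) - k * F ((x - c) / e)).
Proof.
move=> sF; pose A := [set f : R -> R | exists G l, smooth G /\
  f = (fun x => l * G ((x - a) / e) - l * G ((x - c) / e))].
apply: (@smooth_class A); last by exists F, k.
move=> _ [G [l [sG ->]]].
have D x : is_derive x (1 : R) (fun x => l * G ((x - a) / e) - l * G ((x - c) / e))
   ((l / e) * G^`()%classic ((x - a) / e) - (l / e) * G^`()%classic ((x - c) / e)).
  rewrite -!mulrA.
  by apply: is_deriveB; apply: is_derive_affine; exact: smooth_is_derive.
split=> [x|]; first by case: (D x).
exists G^`()%classic, (l / e); split; first exact: smooth_derive1.
by apply/funext => x; rewrite (is_derive_derive1 (D x)).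
Qed.

Definition bump : R -> R := flat 1 0.

Lemma smooth_bump : smooth bump.
Proof.
apply: (@smooth_class [set f | exists P n, f = flat P n]); last by exists 1, 0%N.
move=> _ [P [n ->]]; split=> [x|]; first by case: (is_derive_flat P n x).
exists (flat_deriv P n), n.+2; apply/funext => x.
exact: (is_derive_derive1 (is_derive_flat _ _ _)).
Qed.

Lemma bump_gt0 x : 0 < x < 1 -> 0 < bump x.
Proof.
move=> /andP[x0 x1]; rewrite /bump /flat expr0 mul1r hornerC mul1r.
by rewrite mulr_gt0 ?subr_gt0// expR_gt0.
Qed.

Lemma bump_eq0 x : (x <= 0) || (1 <= x) -> bump x = 0.
Proof.
move=> H; rewrite /bump /flat ifF//; apply/negbTE; rewrite -leNgt.
by case/orP: H => H; [apply: mulr_le0_ge0|apply: mulr_ge0_le0]; lra.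
Qed.

Lemma bump_ge0 x : 0 <= bump x.
Proof.
have [x0|x0] := leP x 0; first by rewrite bump_eq0// x0.
have [x1|x1] := leP 1 x; first by rewrite bump_eq0// x1 orbT.
by apply/ltW/bump_gt0/andP.
Qed.

Lemma within_continuous_segment f (a b : R) :
  (forall x, a <= x <= b -> {for x, continuous f}) -> {within `[a, b], continuous f}.
Proof.
move=> cf; apply: continuous_in_subspaceT => x; rewrite inE/= in_itv/=.
exact: cf.
Qed.

Lemma segment_integrable f (a b : R) :
  {within `[a, b], continuous f} ->
  (@lebesgue_measure R).-integrable `[a, b] (EFin \o f).
Proof. by move=> cf; apply: continuous_compact_integrable => //; exact: segment_compact. Qed.

Lemma is_derive_primitive f (a x : R) : a < x ->
  (forall y, {for y, continuous f}) ->
  is_derive x (1 : R) (fun y => \int[@lebesgue_measure R]_(t in `[a, y]) f t) (f x).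
Proof.
move=> ax cf.
have [] := @continuous_FTC1_closed _ f a x (x + 1) _ _ ax (cf x).
- by rewrite ltrDl.
- by apply: segment_integrable; exact: within_continuous_segment.
move=> dF E; apply: DeriveDef; first exact: dF.
by rewrite -derive1E E.
Qed.

(** Primitive of the bump: 0 on the left of 0 and a positive constant on the
    right of 1.  The lower bound lies to the left of 0 so that the derivative at
    0 is covered by the fundamental theorem of calculus. *)
Definition step x : R := \int[@lebesgue_measure R]_(t in `[(-1)%R, x]) bump t.

Lemma step_le0 x : x <= 0 -> step x = 0.
Proof.
move=> x0; rewrite /step (_ : 0 = \int[@lebesgue_measure R]_(t in `[(-1)%R, x]) (cst 0 t)).
  apply: eq_Rintegral => t; rewrite inE/= in_itv/= => /andP[_ tx].
  by rewrite bump_eq0// (le_trans tx x0).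
by rewrite Rintegral_cst// mul0r.
Qed.

Lemma is_derive_step x : is_derive x (1 : R) step (bump x).
Proof.
have [x0|x0] := ltP x 0.
  rewrite bump_eq0 ?(ltW x0)//; apply: (near_eq_is_derive _ (is_derive_cst (0 : R) x (1 : R))).
  by near=> y; rewrite step_le0//; apply/ltW; near: y; exact: lt_nbhsl.
apply: is_derive_primitive; first by rewrite (lt_le_trans _ x0)// ltrN10.
by apply: derivable_continuous => y; exact: smooth_derivable smooth_bump.
Unshelve. all: by end_near. Qed.

Lemma step_ge1 x : 1 <= x -> step x = step 1.
Proof.
move=> x1; have [y _| |y] := @MVT_segment R step bump 1 x x1.
- exact: is_derive_step.
- by apply: within_continuous_segment => y _; exact: is_derive_continuous (is_derive_step y).
rewrite in_itv/= => /andP[y1 _] /eqP.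
by rewrite bump_eq0 ?y1 ?orbT// mul0r subr_eq0 => /eqP.
Qed.

Lemma step1_gt0 : 0 < step 1.
Proof.
have [y _| |y] := @MVT R step bump 0 1 ltr01.
- exact: is_derive_step.
- by apply: within_continuous_segment => y _; exact: is_derive_continuous (is_derive_step y).
rewrite in_itv/= => y01; rewrite (step_le0 (lexx 0)) !subr0 mulr1 => ->.
exact: bump_gt0.
Qed.

Lemma smooth_step : smooth step.
Proof.
apply: (@smooth_class [set f | f = step \/ smooth f]); last by left.
have E : step^`()%classic = bump.
  by apply/funext => x; exact: is_derive_derive1 (is_derive_step x).
move=> f [->|sf]; split.
- by move=> x; case: (is_derive_step x).
- by right; rewrite E; exact: smooth_bump.
- by move=> x; exact: smooth_derivable.
- by right; exact: smooth_derive1.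
Qed.

(** Difference of two steps of width e, at a and at c: a test function whose
    derivative is a spike at a minus a spike at c. *)
Definition plateau (k a c e x : R) : R :=
  k * step ((x - a) / e) - k * step ((x - c) / e).

Lemma smooth_plateau k a c e : smooth (plateau k a c e).
Proof. exact/smooth_affine_difference/smooth_step. Qed.

Lemma is_derive_plateau k a c e x : is_derive x (1 : R) (plateau k a c e)
  (k * (e^-1 * bump ((x - a) / e)) - k * (e^-1 * bump ((x - c) / e))).
Proof.
by apply: is_deriveB; apply: is_derive_affine; exact: is_derive_step.
Qed.

Lemma plateau_support k a c e x : 0 < e -> a <= c -> x \notin `[a, c + e] ->
  plateau k a c e x = 0.
Proof.
move=> e0 ac; rewrite in_itv/= negb_and -!ltNge /plateau => /orP[xa|xc].
  by rewrite !step_le0 ?mulr0 ?subr0// ler_pdivrMr// mul0r subr_le0; lra.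
rewrite (@step_ge1 ((x - a) / e)) ?(@step_ge1 ((x - c) / e)) ?subrr//;
  by rewrite ler_pdivlMr// mul1r; lra.
Qed.

End smooth.

(** * The du Bois-Reymond lemma *)
Section du_bois_reymond.
Variables (R : realType) (T : R).
Hypothesis T_gt0 : 0 < T.
Local Notation mu := (@lebesgue_measure R).
Implicit Types (f p q Q : R -> R) (x : R).

Let spike (a e t : R) : R := bump ((t - a) / e).

Let is_derive_spike_primitive (a e t : R) : 0 < e ->
  is_derive t (1 : R) (fun y => e * step ((y - a) / e)) (spike a e t).
Proof.
move=> e0; have D := is_derive_affine e (is_derive_step ((t - a) / e)).
by apply: (is_derive_eq D); rewrite mulVKf// gt_eqF.
Qed.

Lemma derivable_oo_LRcontinuous_global (f f' : R -> R) (a b : R) :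
  (forall x, a <= x <= b -> is_derive x (1 : R) f (f' x)) ->
  a < b -> derivable_oo_LRcontinuous f a b.
Proof.
move=> D ab; split.
- move=> x; rewrite in_itv/= => /andP[ax xb].
  by have [] := D x; rewrite ?(ltW ax) ?(ltW xb).
- apply: cvg_at_right_filter; apply: (@is_derive_continuous _ f a (f' a)).
  by apply: D; rewrite lexx ltW.
- apply: cvg_at_left_filter; apply: (@is_derive_continuous _ f b (f' b)).
  by apply: D; rewrite lexx ltW.
Qed.

Let continuous_spike (a e : R) : {within `[0, T], continuous (spike a e)}.
Proof.
apply: within_continuous_segment => x _.
have := is_derive_affine 1 (smooth_is_derive ((x - a) / e) (@smooth_bump R)).
rewrite (_ : (fun y => _) = spike a e); first exact: is_derive_continuous.
by apply/funext => y; rewrite mul1r.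
Qed.

Let integral_spike (a e : R) : 0 < e -> 0 <= a -> a + e <= T ->
  \int[mu]_(t in `[0, T]) spike a e t = e * step (1 : R).
Proof.
move=> e0 a0 aeT; rewrite /Rintegral.
rewrite (@continuous_FTC2 _ _ (fun y => e * step ((y - a) / e)) _ _ T_gt0) //.
- rewrite /= (@step_le0 _ ((0 - a) / e)) ?mulr0 ?subr0.
    by rewrite step_ge1// ler_pdivlMr// mul1r; lra.
  by rewrite ler_pdivrMr// mul0r; lra.
- apply: (@derivable_oo_LRcontinuous_global _ (spike a e)) => // x _.
  exact: is_derive_spike_primitive.
- move=> x _; exact: is_derive_derive1 (is_derive_spike_primitive a x e0).
Qed.

Let within_continuousM f g :
  {within `[0, T], continuous f} -> {within `[0, T], continuous g} ->
  {within `[0, T], continuous (fun x => f x * g x)}.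
Proof. by move=> cf cg x; apply: cvgM; [exact: cf|exact: cg]. Qed.


(** Spikes of equal width have equal mass, so if f a < f c then for a small
    width the average of f near a is strictly below its average near c. *)
Lemma spike_average_le f (a c : R) :
  (forall x, 0 <= x <= T -> {for x, continuous f}) ->
  0 < a < T -> 0 < c < T ->
  (forall e, 0 < e -> a + e < T -> c + e < T ->
    \int[mu]_(t in `[0, T]) (f t * bump ((t - a) / e)) =
    \int[mu]_(t in `[0, T]) (f t * bump ((t - c) / e))) ->
  f c <= f a.
Proof.
move=> cf /andP[a0 aT] /andP[c0 cT] fac; rewrite leNgt; apply/negP => lt_fac.
pose m1 := (2 * f a + f c) / 3; pose m2 := (f a + 2 * f c) / 3.
have m12 : m1 < m2 by rewrite /m1 /m2; lra.
have cfa : {for a, continuous f} by apply: cf; rewrite !ltW.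
have cfc : {for c, continuous f} by apply: cf; rewrite !ltW.
have : \forall y \near a, f y <= m1.
  by move/cvgr_le : cfa; apply; rewrite /m1; lra.
rewrite -nbhs_nearE => /nbhs_ballP[r1 /= r10 B1].
have : \forall y \near c, m2 <= f y.
  by move/cvgr_ge : cfc; apply; rewrite /m2; lra.
rewrite -nbhs_nearE => /nbhs_ballP[r2 /= r20 B2].
pose e : R := Num.min (Num.min (r1 / 2) (r2 / 2)) (Num.min ((T - a) / 2) ((T - c) / 2)).
have e0 : 0 < e by rewrite /e !lt_min !divr_gt0 ?subr_gt0.
have [er1 er2 eTa eTc] : [/\ e <= r1 / 2, e <= r2 / 2, e <= (T - a) / 2 & e <= (T - c) / 2].
  by rewrite /e !ge_min !lexx ?orbT.
have aeT : a + e < T by lra.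
have ceT : c + e < T by lra.
have cf' : {within `[0, T], continuous f} by exact: within_continuous_segment.
have I g : {within `[0, T], continuous g} -> mu.-integrable `[0, T] (EFin \o g).
  exact: segment_integrable.
have cm (m : R) b : {within `[0, T], continuous (fun t => m * spike b e t)}.
  by apply: within_continuousM => //; exact: cst_continuous.
have S b t : (t - b) / e <= 0 \/ 1 <= (t - b) / e \/ b <= t <= b + e.
  have [|H1] := leP ((t - b) / e) 0; [by left|right].
  have [|H2] := leP 1 ((t - b) / e); [by left|right].
  move: H1 H2; rewrite ltr_pdivlMr// mul0r ltr_pdivrMr// mul1r; lra.
have P1 : \int[mu]_(t in `[0, T]) (f t * spike a e t) <= m1 * (e * step (1 : R)).
  rewrite -(@integral_spike a _ e0 (ltW a0) (ltW aeT)) -RintegralZl//; last exact/I/continuous_spike.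
  apply: le_Rintegral => //; [exact/I/within_continuousM|exact/I/cm|].
  move=> t _; case: (S a t) => [H|[H|H]].
  - by rewrite /spike bump_eq0 ?H// !mulr0.
  - by rewrite /spike bump_eq0 ?H ?orbT// !mulr0.
  - rewrite ler_wpM2r ?bump_ge0//; apply: B1 => /=.
    by rewrite /ball/= ltr_distlC; lra.
have P2 : m2 * (e * step (1 : R)) <= \int[mu]_(t in `[0, T]) (f t * spike c e t).
  rewrite -(@integral_spike c _ e0 (ltW c0) (ltW ceT)) -RintegralZl//; last exact/I/continuous_spike.
  apply: le_Rintegral => //; [exact/I/cm|exact/I/within_continuousM|].
  move=> t _; case: (S c t) => [H|[H|H]].
  - by rewrite /spike bump_eq0 ?H// !mulr0.
  - by rewrite /spike bump_eq0 ?H ?orbT// !mulr0.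
  - rewrite ler_wpM2r ?bump_ge0//; apply: B2 => /=.
    by rewrite /ball/= ltr_distlC; lra.
have P3 := fac e e0 aeT ceT; have := P1; rewrite P3 => /(le_trans P2).
by rewrite (ler_pM2r (mulr_gt0 e0 (@step1_gt0 R))) leNgt m12.
Qed.

(** Integration by parts turns the hypothesis into the vanishing of the integral
    of (p - Q) theta' for every test function theta; plateaus then compare
    p - Q at any two interior points, and continuity adds the end points. *)
Lemma du_bois_reymond p q Q :
  (forall x, {for x, continuous p}) -> (forall x, {for x, continuous q}) ->
  (forall x, 0 <= x -> is_derive x (1 : R) Q (q x)) ->
  (forall th, smooth th ->
     (exists a c, [/\ 0 < a, c < T & forall t, t \notin `[a, c] -> th t = 0]) ->
     \int[mu]_(t in `[0, T]) (q t * th t + p t * th^`()%classic t) = 0) ->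
  forall t, 0 <= t <= T -> p t - Q t = p 0 - Q 0.
Proof.
move=> cp cq dQ H.
pose f x := p x - Q x.
have cQ x : 0 <= x -> {for x, continuous Q}.
  by move=> x0; exact: is_derive_continuous (dQ x x0).
have cf x : 0 <= x <= T -> {for x, continuous f}.
  by move=> /andP[x0 _]; apply: cvgB; [exact: cp|exact: cQ].
have I g : {within `[0, T], continuous g} -> mu.-integrable `[0, T] (EFin \o g).
  exact: segment_integrable.
have cp' : {within `[0, T], continuous p} by exact: within_continuous_segment.
have cq' : {within `[0, T], continuous q} by exact: within_continuous_segment.
have cf' : {within `[0, T], continuous f} by exact: within_continuous_segment.
have cQ' : {within `[0, T], continuous Q}.
  by apply: within_continuous_segment => x /andP[x0 _]; exact: cQ.
have Hf th : smooth th ->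
   (exists a c, [/\ 0 < a, c < T & forall t, t \notin `[a, c] -> th t = 0]) ->
   \int[mu]_(t in `[0, T]) (f t * th^`()%classic t) = 0.
  move=> sth supp; have := H _ sth supp.
  have cth : {within `[0, T], continuous th}.
    apply: within_continuous_segment => x _.
    exact: is_derive_continuous (smooth_is_derive x sth).
  have cth' : {within `[0, T], continuous th^`()%classic}.
    apply: within_continuous_segment => x _.
    exact: is_derive_continuous (smooth_is_derive x (smooth_derive1 sth)).
  have := @Rintegration_by_parts _ Q th q th^`()%classic 0 T T_gt0 cq' _ _ cth' _ _.
  have [a [c [a0 cT th0]]] := supp.
  rewrite (th0 0) ?(th0 T) ?in_itv/= ?negb_and -?ltNge ?a0 ?cT ?orbT//.
  rewrite !mulr0 subr0 sub0r => IBP.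
  rewrite RintegralD//; [|exact/I/within_continuousM|exact/I/within_continuousM].
  move/eqP; rewrite addrC addr_eq0 => /eqP Hp.
  under eq_Rintegral do rewrite mulrBl.
  rewrite RintegralB//; [|exact/I/within_continuousM|exact/I/within_continuousM].
  rewrite Hp IBP ?subrr//.
  - apply: (@derivable_oo_LRcontinuous_global _ q) => // x /andP[x0 _].
    exact: dQ.
  - move=> x; rewrite in_itv/= => /andP[x0 _]; apply: is_derive_derive1.
    by apply: dQ; exact: ltW.
  - apply: (@derivable_oo_LRcontinuous_global _ th^`()%classic) => // x _.
    exact: smooth_is_derive.
have fle (a c : R) : 0 < a -> a < c -> c < T -> f a = f c.
  move=> a0 ac cT.
  have E (e : R) : 0 < e -> c + e < T ->
    \int[mu]_(t in `[0, T]) (f t * spike a e t) =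
    \int[mu]_(t in `[0, T]) (f t * spike c e t).
    move=> e0 ceT.
    (* the amplitude e makes both spikes of the derivative have height one *)
    have := Hf _ (@smooth_plateau R e a c e).
    have -> : (plateau e a c e)^`()%classic = (fun t => spike a e t - spike c e t).
      apply/funext => x; rewrite (is_derive_derive1 (is_derive_plateau _ _ _ _ _)).
      by rewrite !mulVKf// gt_eqF.
    under eq_Rintegral do rewrite mulrBr.
    have iM g : {within `[0, T], continuous g} -> mu.-integrable `[0, T] (EFin \o (fun t => f t * g t)).
      by move=> cg; apply: I; exact: within_continuousM.
    rewrite RintegralB; [|by []|exact: (iM _ (@continuous_spike a e))|
      exact: (iM _ (@continuous_spike c e))].
    move=> /(_ _)/eqP; rewrite subr_eq0 => HH; apply/eqP/HH.
    exists a, (c + e); split=> // t tac.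
    exact: plateau_support (ltW ac) tac.
  have a0T : 0 < a < T by rewrite a0 (lt_trans ac cT).
  have c0T : 0 < c < T by rewrite (lt_trans a0 ac) cT.
  apply/eqP; rewrite eq_le; apply/andP; split.
    apply: (spike_average_le cf c0T a0T) => e e0 ce _; exact/esym/(E _ e0 ce).
  apply: (spike_average_le cf a0T c0T) => e e0 _ ce; exact: (E _ e0 ce).
have fcst (x : R) : 0 < x < T -> f x = f (T / 2).
  move=> /andP[x0 xT]; have [| |->//] := ltgtP x (T / 2) => h.
    by apply: fle; lra.
  by apply/esym/fle; lra.
suff fe x : 0 <= x <= T -> f x = f (T / 2).
  by move=> t tT; rewrite -/(f t) -/(f 0) fe// fe// lexx ltW.
move=> /andP[]; rewrite le_eqVlt => /orP[/eqP <- _|x0].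
  have h1 : f y @[y --> 0^'+] --> f 0.
    by apply: cvg_at_right_filter; apply: cf; rewrite lexx ltW.
  apply: (cvg_unique _ h1) => //; apply: cvg_near_cst; near=> y.
  by apply: fcst; apply/andP; split; near: y; [exact: nbhs_right_gt|exact: nbhs_right_lt].
rewrite le_eqVlt => /orP[/eqP ->|xT]; last by apply: fcst; rewrite x0.
have h1 : f y @[y --> T^'-] --> f T.
  by apply: cvg_at_left_filter; apply: cf; rewrite lexx ltW.
apply: (cvg_unique _ h1) => //; apply: cvg_near_cst; near=> y.
by apply: fcst; apply/andP; split; near: y; [exact: nbhs_left_gt|exact: nbhs_left_lt].
Unshelve. all: by end_near. Qed.
End du_bois_reymond.

(** * First-order expansions along a filter *)
Section expansions.
Variables (R : realType) (X : Type) (F : set_system X) (N : X -> R).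
Hypothesis FF : Filter F.
Hypothesis N_ge0 : forall x, 0 <= N x.
Hypothesis N_cvg0 : N x @[x --> F] --> (0 : R).
Implicit Types (H G l k : X -> R) (a b : R).

(** H = a + l + o(N) along F, with l = O(N).  Partial derivatives, derivatives
    in t on [0, T] and L-derivatives at Dirac masses are all of this form, so
    that the rules of calculus are proved once for the three of them. *)
Definition expands H a l :=
  (exists C, \forall x \near F, `|l x| <= C * N x) /\
  forall e, 0 < e -> \forall x \near F, `|H x - a - l x| <= e * N x.

Lemma expands_ext H G a b l k : (forall x, H x = G x) -> a = b ->
  (forall x, l x = k x) -> expands H a l -> expands G b k.
Proof. by move=> /funext -> -> /funext ->. Qed.

Lemma expands_near H G a l : (\forall x \near F, H x = G x) ->
  expands H a l -> expands G a l.
Proof.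
move=> HG [C h]; split=> // e /h {}h.
by near=> x; rewrite -(near HG x)//; near: x.
Unshelve. all: by end_near. Qed.

Lemma expands_cst (c : R) : expands (fun=> c) c (fun=> 0).
Proof.
split; first by exists 0; apply: nearW => x; rewrite normr0 mul0r.
by move=> e e0; apply: nearW => x; rewrite subrr subr0 normr0 mulr_ge0// ltW.
Qed.

Lemma expandsD H G a b l k : expands H a l -> expands G b k ->
  expands (fun x => H x + G x) (a + b) (fun x => l x + k x).
Proof.
move=> [[C hC] hH] [[D hD] hG]; split.
  exists (C + D); near=> x; rewrite (le_trans (ler_normD _ _))// mulrDl lerD//.
    by near: x.
  by near: x.
move=> e e0; have e2 : 0 < e / 2 by rewrite divr_gt0.
near=> x.
have -> : H x + G x - (a + b) - (l x + k x) = (H x - a - l x) + (G x - b - k x).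
  by ring.
rewrite (le_trans (ler_normD _ _))// [e]splitr mulrDl lerD//; near: x; [exact: hH|exact: hG].
Unshelve. all: by end_near. Qed.

Lemma expands_cvg H a l : expands H a l -> H x @[x --> F] --> a.
Proof.
move=> [[C hC] hH]; apply/cvgrPdist_le => e e0.
have C1 : 0 < `|C| + 1 by apply: ltr_wpDl.
near=> x.
have h1 : `|H x - a - l x| <= 1 * N x by near: x; exact: hH.
have h2 : `|l x| <= C * N x by near: x.
have h3 : N x <= e / (`|C| + 1).
  near: x; move/cvgr_le: N_cvg0; apply; exact: divr_gt0.
rewrite distrC; have -> : H x - a = (H x - a - l x) + l x by ring.
apply: (le_trans (ler_normD _ _)); apply: (le_trans (lerD h1 h2)).
rewrite -mulrDl; move: h3; rewrite ler_pdivlMr// mulrC; apply: le_trans.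
by rewrite ler_wpM2r// addrC lerD2r ler_norm.
Unshelve. all: by end_near. Qed.

(** The factor S only needs a limit, as the expansion of H starts at order one;
    both the product rule and the inversion of linear systems rest on this. *)
Lemma expandsM0 (S : X -> R) (S0 : R) H l : S x @[x --> F] --> S0 -> expands H 0 l ->
  expands (fun x => S x * H x) 0 (fun x => S0 * l x).
Proof.
move=> cS [[C hC] hH]; split.
  by exists (`|S0| * C); near=> x; rewrite normrM -mulrA ler_wpM2l//; near: x.
move=> e e0; have e2 : 0 < e / 2 by rewrite divr_gt0.
have C1 : 0 < `|C| + 1 by apply: ltr_wpDl.
have S1 : 0 < `|S0| + 1 by apply: ltr_wpDl.
near=> x.
have h1 : `|H x - 0 - l x| <= (e / 2 / (`|S0| + 1)) * N x.
  by near: x; apply: hH; rewrite divr_gt0.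
have h2 : `|l x| <= C * N x by near: x.
have h3 : `|S0 - S x| <= e / 2 / (`|C| + 1).
  by near: x; move/cvgrPdist_le: cS; apply; rewrite divr_gt0.
have h4 : `|S x| <= `|S0| + 1.
  near: x; have /cvgrPdist_le/(_ _ ltr01) := cS.
  by apply: filterS => y hy; rewrite -[S y](subKr S0) (le_trans (ler_normB _ _))// lerD2l.
have -> : S x * H x - 0 - S0 * l x = S x * (H x - 0 - l x) - (S0 - S x) * l x by ring.
rewrite (le_trans (ler_normB _ _))// !normrM [e]splitr mulrDl lerD//.
  apply: (@le_trans _ _ ((`|S0| + 1) * (e / 2 / (`|S0| + 1) * N x))).
    by rewrite ler_pM.
  by rewrite mulrA mulrCA divff ?gt_eqF// mulr1.
apply: (@le_trans _ _ (e / 2 / (`|C| + 1) * (C * N x))); first by rewrite ler_pM.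
rewrite mulrA ler_wpM2r// mulrAC ler_pdivrMr// (ler_wpM2l (ltW e2))//.
by rewrite (le_trans (ler_norm C))// lerDl.
Unshelve. all: by end_near. Qed.

Lemma expandsZ (c : R) H a l : expands H a l ->
  expands (fun x => c * H x) (c * a) (fun x => c * l x).
Proof.
move=> eH.
have e0 : expands (fun x => H x - a) 0 l.
  apply: expands_ext (expandsD eH (expands_cst (- a))) => [//| |x].
    by rewrite subrr.
  by rewrite addr0.
have cc : (fun=> c) x @[x --> F] --> c by exact: cvg_cst.
apply: expands_ext (expandsD (expandsM0 cc e0) (expands_cst (c * a))).
- by move=> x; rewrite mulrBr subrK.
- by rewrite add0r.
- by move=> x; rewrite addr0.
Qed.

Lemma expandsB H G a b l k : expands H a l -> expands G b k ->
  expands (fun x => H x - G x) (a - b) (fun x => l x - k x).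
Proof.
move=> eH eG; apply: expands_ext (expandsD eH (expandsZ (-1) eG)) => [x||x];
  by rewrite mulN1r.
Qed.

Lemma expandsM H G a b l k : expands H a l -> expands G b k ->
  expands (fun x => H x * G x) (a * b) (fun x => a * k x + b * l x).
Proof.
move=> eH eG.
have e0 : expands (fun x => G x - b) 0 k.
  apply: expands_ext (expandsB eG (expands_cst b)) => [//| |x].
    by rewrite subrr.
  by rewrite subr0.
apply: expands_ext (expandsD (expandsM0 (expands_cvg eH) e0) (expandsZ b eH)).
- by move=> x; ring.
- by rewrite add0r mulrC.
- by [].
Qed.

Lemma expands_sum n (H : 'I_n -> X -> R) (a : 'I_n -> R) (l : 'I_n -> X -> R) :
  (forall i, expands (H i) (a i) (l i)) ->
  expands (fun x => \sum_i H i x) (\sum_i a i) (fun x => \sum_i l i x).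
Proof.
elim: n H a l => [|n IH] H a l h.
  apply: expands_ext (expands_cst 0) => [x||x]; by rewrite big_ord0.
apply: expands_ext (expandsD (h ord0) (IH _ _ _ (fun i => h (lift ord0 i)))) => [x||x];
  by rewrite big_ord_recl.
Qed.

End expansions.

(** The link with difference quotients, N being the modulus of the increment. *)
Section quotients.
Variables (R : realType) (X : Type) (F : set_system X) (k : X -> R).
Hypothesis FF : Filter F.
Hypothesis k_neq0 : \forall x \near F, k x != 0.

Lemma expands_quotient (H : X -> R) (a d : R) :
  expands F (fun x => `|k x|) H a (fun x => d * k x) <->
  ((H x - a) / k x @[x --> F] --> d).
Proof.
split=> [[_ h]|/cvgrPdist_le h].
  apply/cvgrPdist_le => e /h {}h; near=> x.
  have k0 : k x != 0 by near: x.
  rewrite distrC -(ler_pM2r (_ : 0 < `|k x|)) ?normr_gt0// -normrM mulrBl divfK//.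
  by near: x.
split; first by exists `|d|; apply: nearW => x; rewrite normrM.
move=> e /h {}h; near=> x.
have k0 : k x != 0 by near: x.
rewrite -[X in `|X - _|](divfK k0) -mulrBl normrM ler_wpM2r// distrC.
by near: x.
Unshelve. all: by end_near. Qed.

End quotients.

(** * L-derivatives at Dirac masses *)
Section euclidean_facts.
Variables (R : realType) (d : nat).
Local Notation V := 'cV[R]_d.
Implicit Types (x y v w : V).

Lemma dotE x y : dot x y = \sum_i x i ord0 * y i ord0.
Proof. by rewrite /dot mxE; apply: eq_bigr => i _; rewrite mxE. Qed.

Lemma sqnormE x : sqnorm x = \sum_i x i ord0 ^+ 2.
Proof. by rewrite /sqnorm dotE; apply: eq_bigr => i _; rewrite expr2. Qed.

Lemma sqnorm_ge0 x : 0 <= sqnorm x.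
Proof. by rewrite sqnormE; apply: sumr_ge0 => i _; exact: sqr_ge0. Qed.

Lemma enorm_ge0 x : 0 <= enorm x. Proof. exact: sqrtr_ge0. Qed.

Lemma entry_le_enorm x i : `|x i ord0| <= enorm x.
Proof.
rewrite -sqrtr_sqr ler_sqrt ?sqnorm_ge0// sqnormE (bigD1 i)//= lerDl.
by apply: sumr_ge0 => j _; exact: sqr_ge0.
Qed.

Lemma enormZ (a : R) x : enorm (a *: x) = `|a| * enorm x.
Proof.
rewrite /enorm -sqrtr_sqr -sqrtrM ?sqr_ge0//; congr Num.sqrt.
by rewrite !sqnormE mulr_sumr; apply: eq_bigr => i _; rewrite mxE exprMn.
Qed.

Lemma dot_delta v i : dot v (delta_mx i ord0) = v i ord0.
Proof.
rewrite dotE (bigD1 i)//= !mxE !eqxx mulr1 big1 ?addr0// => j ji.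
by rewrite mxE (negbTE ji) mulr0.
Qed.

Lemma dotZr (a : R) v x : dot v (a *: x) = a * dot v x.
Proof. by rewrite /dot -scalemxAr mxE. Qed.

Lemma dot_le v w : `|dot v w| <= (\sum_i `|v i ord0|) * enorm w.
Proof.
rewrite dotE (le_trans (ler_norm_sum _ _ _))// mulr_suml ler_sum// => i _.
by rewrite normrM ler_wpM2l// entry_le_enorm.
Qed.

End euclidean_facts.

Section L_derivative_at_dirac.
Variables (R : realType) (d : nat).
Local Notation V := 'cV[R]_d.
Local Notation BV := (borel V).
Local Notation P2 := (P2 R d).
Implicit Types (h : P2 -> R) (z v w : V) (nu : P2).

(** A measure is a function on all sets, constrained on measurable sets only:
    this says that nu is delta_z as a measure, which is weaker than
    nu = dirac2 z. *)
Definition is_dirac nu z := forall A : set BV, measurable A -> nu A = \d_(z : BV) A.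

Lemma is_dirac_dirac2 z : is_dirac (dirac2 z) z. Proof. by []. Qed.

Lemma is_shift_dirac2 z (psi : V -> V) nu :
  is_shift (dirac2 z) psi nu <-> is_dirac nu (z + psi z).
Proof. by split=> H A mA; rewrite (H A mA) /pushforward /= !diracE. Qed.

Lemma measurable_entry_comp (psi : V -> V) i :
  measurable_fun (setT : set BV) (psi : BV -> BV) ->
  measurable_fun (setT : set BV) (fun x : BV => psi x i ord0).
Proof. by move=> mpsi; exact: (measurableT_comp (measurable_entry i) mpsi). Qed.

Lemma Rintegral_dirac2 (f : V -> R) z :
  measurable_fun (setT : set BV) (f : BV -> R) -> \int[dirac2 z]_x f x = f z.
Proof.
move=> mf; rewrite /Rintegral integral_dirac//; last exact/measurable_EFinP.
by rewrite diracT mul1e.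
Qed.

Lemma L2norm_dirac2 z (psi : V -> V) :
  measurable_fun (setT : set BV) (psi : BV -> BV) ->
  L2norm (dirac2 z) psi = enorm (psi z).
Proof.
move=> mpsi; rewrite /L2norm Rintegral_dirac2//.
exact: (measurableT_comp (@measurable_sqnorm R d) mpsi).
Qed.

Lemma Rintegral_dot_dirac2 z (xi psi : V -> V) :
  measurable_fun (setT : set BV) (xi : BV -> BV) ->
  measurable_fun (setT : set BV) (psi : BV -> BV) ->
  \int[dirac2 z]_x dot (xi x) (psi x) = dot (xi z) (psi z).
Proof.
move=> mxi mpsi; rewrite (@Rintegral_dirac2 (fun x => dot (xi x) (psi x)))//.
rewrite (_ : (fun x => _) = (fun x : BV => \sum_i xi x i ord0 * psi x i ord0)).
  by apply: measurable_sum => i; apply: measurable_funM; exact: measurable_entry_comp.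
by apply/funext => x; rewrite dotE.
Qed.

Lemma sq_integrable_cst z w : sq_integrable (dirac2 z) (cst w).
Proof.
split; first exact: measurable_cst.
rewrite (integral_dirac _ _ (measurable_cst (sqnorm w)%:E))//.
by rewrite diracT mul1e ltry.
Qed.

(** Pairs (w, nu) where nu is delta_(z + w) and w tends to 0: the perturbations
    of delta_z that the L-derivative tests. *)
Definition dirac_shifts z : set_system (V * P2) :=
  [set A | exists2 r : R, 0 < r &
     forall w nu, is_dirac nu (z + w) -> enorm w < r -> A (w, nu)].

Global Instance dirac_shifts_filter z : Filter (dirac_shifts z).
Proof.
split.
- by exists 1.
- move=> A B [r r0 hA] [s s0 hB]; exists (Num.min r s); first by rewrite lt_min r0.
  by move=> w nu dnu; rewrite lt_min => /andP[wr ws]; split; [exact: hA|exact: hB].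
- by move=> A B AB [r r0 hA]; exists r => // w nu dnu wr; exact/AB/hA.
Qed.

Definition Lexpands h z v := expands (dirac_shifts z) (fun p => enorm p.1)
  (fun p => h p.2) (h (dirac2 z)) (fun p => dot v p.1).

Lemma LexpandsP h z v : Lexpands h z v <->
  forall e : R, 0 < e -> exists2 r : R, 0 < r &
    forall w nu, is_dirac nu (z + w) -> enorm w < r ->
    `|h nu - h (dirac2 z) - dot v w| <= e * enorm w.
Proof.
split=> [[_ H]//|H]; split=> //.
by exists (\sum_i `|v i ord0|); exists 1 => // w nu _ _; exact: dot_le.
Qed.

Lemma is_Lderive_Lexpands h z (xi : V -> V) :
  is_Lderive h (dirac2 z) xi -> Lexpands h z (xi z).
Proof.
move=> [[mxi _] H]; apply/LexpandsP => e /H[r r0 {}H]; exists r => // w nu dnu wr.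
have [mw _] := sq_integrable_cst z w.
have := H (cst w) nu (sq_integrable_cst z w).
by rewrite (L2norm_dirac2 z mw) (Rintegral_dot_dirac2 z mxi mw); apply => //;
  exact/is_shift_dirac2.
Qed.

Lemma Lexpands_is_Lderive h z v : Lexpands h z v -> is_Lderive h (dirac2 z) (cst v).
Proof.
move=> /LexpandsP H; split; first exact: sq_integrable_cst.
move=> e /H[r r0 {}H]; exists r => // psi nu [mpsi _] /is_shift_dirac2 dnu.
have [mv _] := sq_integrable_cst z v.
rewrite (L2norm_dirac2 z mpsi) (Rintegral_dot_dirac2 z mv mpsi); exact: H.
Qed.

(** The masses at z + k w are among the perturbations of delta_z; the usual
    derivative of z |-> h delta_z therefore determines the L-derivative. *)
Lemma Lexpands_derivative h z v w : Lexpands h z v ->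
  is_derive z w (h \o @dirac2 R d) (dot v w).
Proof.
move=> /LexpandsP H.
have cv : k^-1 *: ((h \o @dirac2 R d) (k *: w + z) - (h \o @dirac2 R d) z)
    @[k --> (0:R)^'] --> dot v w.
  have w1 : 0 < enorm w + 1 by rewrite ltr_wpDl// enorm_ge0.
  apply/cvgrPdist_le => e e0; have /H[r r0 {}H] : 0 < e / (enorm w + 1) by rewrite divr_gt0.
  near=> k.
  have k0 : k != 0 by near: k; exact: nbhs_dnbhs_neq.
  rewrite /= (addrC _ z).
  have h1 := H (k *: w) (dirac2 (z + k *: w)) (is_dirac_dirac2 _).
  rewrite enormZ dotZr in h1.
  rewrite distrC -(ler_pM2r (_ : 0 < `|k|)) ?normr_gt0// -normrM mulrBl.
  rewrite -[_ *: _ * k]/(k^-1 * _ * k) mulrAC mulVf// mul1r (mulrC (dot v w)).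
  apply: (le_trans (h1 _)).
    rewrite (@le_lt_trans _ _ (`|k| * (enorm w + 1)))//.
      by rewrite ler_wpM2l// lerDl.
    rewrite -ltr_pdivlMr//; near: k; apply: dnbhs0_lt; exact: divr_gt0.
  rewrite mulrCA mulrC ler_wpM2r// mulrAC ler_pdivrMr// ler_wpM2l ?(ltW e0)//.
  by rewrite lerDl.
apply: DeriveDef; first by apply/cvg_ex; exists (dot v w).
exact/cvg_lim.
Unshelve. all: by end_near. Qed.

Lemma Lexpands_partial h z v i : Lexpands h z v ->
  is_derive z (delta_mx i ord0 : V) (h \o @dirac2 R d) (v i ord0).
Proof. by move=> /(Lexpands_derivative (delta_mx i ord0)); rewrite dot_delta. Qed.

Lemma Lexpands_unique h z v v' : Lexpands h z v -> Lexpands h z v' -> v = v'.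
Proof.
move=> H H'; apply/matrixP => i j; rewrite [j]ord1.
have [_ <-] := Lexpands_partial i H.
by have [_ <-] := Lexpands_partial i H'.
Qed.

Lemma Lexpands_Lderive h z v : Lexpands h z v -> Lderive h z = v.
Proof.
move=> H; rewrite /Lderive; case: xgetP => [y ->|/(_ v)].
  by move=> [xi [/is_Lderive_Lexpands H' ->]]; exact: Lexpands_unique H' H.
by case; exists (cst v); split=> //; exact: Lexpands_is_Lderive.
Qed.

Lemma Ldifferentiable_Lexpands h z :
  Ldifferentiable h (dirac2 z) -> Lexpands h z (Lderive h z).
Proof.
by move=> [xi /is_Lderive_Lexpands H]; rewrite (Lexpands_Lderive H).
Qed.

Lemma dirac_shifts_enorm z : enorm p.1 @[p --> dirac_shifts z] --> (0 : R).
Proof.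
apply/cvgr0Pnorm_lt => e e0; exists e => // w nu _ /=.
by rewrite ger0_norm// enorm_ge0.
Qed.

(** The coupling that is a Dirac mass at (z, z + w) has cost |w|^2. *)
Lemma W2_dirac_le nu z w : is_dirac nu (z + w) -> W2 (dirac2 z) nu <= enorm w.
Proof.
move=> dnu; rewrite /W2 /enorm ler_sqrt ?sqnorm_ge0//.
have -> : sqnorm w = fine (sqnorm w)%:E by [].
have W0 : (0 <= W2sq (dirac2 z) nu)%E.
  apply: le_ereal_inf_tmp => _ [pi [_ _ ->]]; apply: integral_ge0 => p _.
  by rewrite lee_fin sqnorm_ge0.
have W1 : (W2sq (dirac2 z) nu <= (sqnorm w)%:E)%E.
  apply: ge_ereal_inf; exists (sqnorm w)%:E => //.
  exists (@dirac _ (BV * BV)%type ((z : BV), (z + w : BV)) R); split.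
  - move=> A mA; rewrite /= !diracE; congr ((nat_of_bool _)%:R%:E).
    by apply/idP/idP; rewrite !inE => //= -[].
  - move=> A mA; rewrite (dnu A mA) /= !diracE; congr ((nat_of_bool _)%:R%:E).
    by apply/idP/idP; rewrite !inE => //= -[].
  rewrite integral_dirac//=.
    rewrite diracT mul1e; congr (_%:E); rewrite !sqnormE; apply: eq_bigr => i _.
    by rewrite !mxE; ring.
  apply/measurable_EFinP.
  rewrite (_ : (fun x => _) = (fun p : BV * BV =>
     \sum_i ((p.1 : V) i ord0 - (p.2 : V) i ord0) ^+ 2)).
    apply: measurable_sum => i; apply: measurable_funX; apply: measurable_funB.
      exact: (measurableT_comp (measurable_entry i) measurable_fst).
    exact: (measurableT_comp (measurable_entry i) measurable_snd).
  by apply/funext => p; rewrite sqnormE; apply: eq_bigr => i _; rewrite !mxE.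
apply: fine_le => //; last by rewrite ge0_fin_numE// (le_lt_trans W1)// ltry.
Qed.

Lemma dirac_shifts_cvg z : p.2 @[p --> dirac_shifts z] --> dirac2 z.
Proof.
move=> A; rewrite nbhsE => -[U [oU Uz] UA].
have [r r0 Ur] := oU _ Uz.
exists r => // w nu dnu wr; apply/UA/Ur.
exact: le_lt_trans (W2_dirac_le dnu) wr.
Qed.

End L_derivative_at_dirac.

(** * Expansions with a linear first-order term *)
Section linear_expansions.
Variables (R : realType) (X : Type) (F : set_system X) (N : X -> R).
Hypothesis FF : Filter F.
Hypothesis N_ge0 : forall x, 0 <= N x.
Hypothesis N_cvg0 : N x @[x --> F] --> (0 : R).
Variables (U : lmodType R) (Lam : U -> X -> R).
Hypothesis Lam_linear : forall x a u v, Lam (a *: u + v) x = a * Lam u x + Lam v x.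
Implicit Types (H G : X -> R) (a b c : R) (u v : U).

Let Lam0 x : Lam 0 x = 0.
Proof. by have := Lam_linear x 1 0 0; rewrite scaler0 addr0 mul1r; lra. Qed.
Let LamD u v x : Lam (u + v) x = Lam u x + Lam v x.
Proof. by have := Lam_linear x 1 u v; rewrite scale1r mul1r. Qed.
Let LamZ a u x : Lam (a *: u) x = a * Lam u x.
Proof. by have := Lam_linear x a u 0; rewrite addr0 Lam0 addr0. Qed.
Let Lam_sum n (u : 'I_n -> U) x : Lam (\sum_i u i) x = \sum_i Lam (u i) x.
Proof. by apply: (big_morph (Lam^~ x)) => // *; rewrite ?LamD ?Lam0. Qed.

Local Notation lexp H a u := (expands F N H a (Lam u)).

Lemma lexp_cst c : lexp (fun=> c) c 0.
Proof. by apply: expands_ext (expands_cst FF N_ge0 c) => // x; rewrite Lam0. Qed.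

Lemma lexpD H G a b u v : lexp H a u -> lexp G b v ->
  lexp (fun x => H x + G x) (a + b) (u + v).
Proof.
by move=> eH eG; apply: expands_ext (expandsD FF eH eG) => // x; rewrite LamD.
Qed.

Lemma lexpZ c H a u : lexp H a u -> lexp (fun x => c * H x) (c * a) (c *: u).
Proof.
by move=> eH; apply: expands_ext (expandsZ FF N_ge0 c eH) => // x; rewrite LamZ.
Qed.

Lemma lexpM H G a b u v : lexp H a u -> lexp G b v ->
  lexp (fun x => H x * G x) (a * b) (a *: v + b *: u).
Proof.
move=> eH eG; apply: expands_ext (expandsM FF N_ge0 N_cvg0 eH eG) => // x.
by rewrite LamD !LamZ.
Qed.

Lemma lexp_sum n (H : 'I_n -> X -> R) (a : 'I_n -> R) (u : 'I_n -> U) :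
  (forall i, lexp (H i) (a i) (u i)) ->
  lexp (fun x => \sum_i H i x) (\sum_i a i) (\sum_i u i).
Proof.
by move=> h; apply: expands_ext (expands_sum FF N_ge0 h).
Qed.

(** Differentiability of the solution B of A B = c.  From
    B - B0 = S (A B - A0 B0 - (A - A0) B0), where S = A^-1, the bracket expands
    from 0 and S only needs to converge: derivatives of S do not enter. *)
Lemma lexp_solve n (S A : X -> 'M[R]_n) (B : X -> 'cV[R]_n)
    (S0 A0 : 'M[R]_n) (B0 : 'cV[R]_n)
    (uA : 'I_n -> 'I_n -> U) (uc : 'I_n -> U) :
  (forall i j, S x i j @[x --> F] --> S0 i j) ->
  (\forall x \near F, S x *m A x = 1%:M) -> S0 *m A0 = 1%:M ->
  (forall i j, lexp (fun x => A x i j) (A0 i j) (uA i j)) ->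
  (forall i, lexp (fun x => (A x *m B x) i ord0) ((A0 *m B0) i ord0) (uc i)) ->
  forall k, lexp (fun x => B x k ord0) (B0 k ord0)
    (\sum_j S0 k j *: (uc j - \sum_l B0 l ord0 *: uA j l)).
Proof.
move=> cS SA SA0 hA hc k.
pose w j := uc j - \sum_l B0 l ord0 *: uA j l.
pose G j x := (A x *m B x) j ord0 - \sum_l B0 l ord0 * A x j l.
have hG j : lexp (G j) 0 (w j).
  have h1 : lexp (fun x => -1 * \sum_l B0 l ord0 * A x j l)
     (-1 * \sum_l B0 l ord0 * A0 j l) (-1 *: \sum_l B0 l ord0 *: uA j l).
    by apply: lexpZ; apply: lexp_sum => l; exact: lexpZ.
  apply: expands_ext (lexpD (hc j) h1) => [x||x].
  - by rewrite mulN1r.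
  - by rewrite mulN1r mxE -sumrB big1// => l _; rewrite mulrC subrr.
  - by rewrite scaleN1r.
have hS j : expands F N (fun x => S x k j * G j x) 0 (fun x => S0 k j * Lam (w j) x).
  exact: expandsM0.
have := expandsD FF (expands_cst FF N_ge0 (B0 k ord0)) (expands_sum FF N_ge0 hS).
rewrite big1// addr0 => h.
apply: (@expands_near _ _ _ _ FF (fun x => B0 k ord0 + \sum_j S x k j * G j x)).
  near=> x; have SAx : S x *m A x = 1%:M by near: x.
  have -> : \sum_j S x k j * G j x = (S x *m (A x *m B x - A x *m B0)) k ord0.
    rewrite mxE; apply: eq_bigr => j _; rewrite /G !mxE; congr (_ * (_ - _)).
    by apply: eq_bigr => l _; rewrite mulrC.
  by rewrite mulmxBr !mulmxA SAx !mul1mx !mxE addrCA subrr addr0.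
apply: expands_ext h => // x.
by rewrite add0r Lam_sum; apply: eq_bigr => j _; rewrite LamZ.
Unshelve. all: by end_near. Qed.

End linear_expansions.

Section directional_expansions.
Variables (R : realType).

Lemma is_derive_cvgP (V : normedModType R) (f : V -> R) x v a :
  is_derive x v f a <->
  (h^-1 *: (f (h *: v + x) - f x) @[h --> (0:R)^'] --> a).
Proof.
split=> [[/cvg_ex[l h] <-]|h]; first by rewrite /derive (cvg_lim _ h).
apply: DeriveDef; first by apply/cvg_ex; exists a.
exact/cvg_lim.
Qed.

Lemma is_derive_expandsP (V : normedModType R) (f : V -> R) x v a :
  is_derive x v f a <->
  expands (0:R)^' (fun h => `|h|) (fun h => f (h *: v + x)) (f x) (fun h => a * h).
Proof.
have nz : \forall h \near (0:R)^', h != 0 by exact: nbhs_dnbhs_neq.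
rewrite (@expands_quotient R R (0:R)^' id _ nz) is_derive_cvgP.
by under eq_fun do rewrite [_ *: _]mulrC.
Qed.

(** The one-variable mean value theorem on the segment from x to x + w. *)
Lemma mvt_direction (V : normedModType R) (f D : V -> R) (x w : V) :
  (forall s : R, is_derive (x + s *: w) w f (D (x + s *: w))) ->
  exists2 s, 0 <= s <= 1 & f (x + w) - f x = D (x + s *: w).
Proof.
move=> df.
pose g s := f (x + s *: w).
have dg s : is_derive s (1 : R) g (D (x + s *: w)).
  have /is_derive_cvgP h := df s; apply/is_derive_cvgP.
  rewrite (_ : (fun h => _) =
      (fun h => h^-1 *: (f (h *: w + (x + s *: w)) - f (x + s *: w)))) //.
  apply/funext => k; congr (_ *: (f _ - _)).
  by rewrite [k *: 1]mulr1 scalerDl addrCA.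
have [|s] := @MVT_segment _ g (fun s => D (x + s *: w)) 0 1 ler01.
  by apply: within_continuous_segment => s _; exact: is_derive_continuous (dg s).
rewrite in_itv/= => s01; rewrite /g scale1r scale0r addr0 subr0 mulr1 => E.
by exists s.
Qed.

End directional_expansions.

(** * Calculus of the operator D *)
Section opD_calculus.
Variables (R : realType) (d : nat).
Local Notation V := 'cV[R]_d.
Local Notation P2 := (P2 R d).
Implicit Types (f g : V -> P2 -> R) (h k : P2 -> R) (z v w : V) (i : 'I_d).

Lemma dot_linear_l (x : V * P2) (a : R) u v :
  dot (a *: u + v) x.1 = a * dot u x.1 + dot v x.1.
Proof.
by rewrite !dotE mulr_sumr -big_split/=; apply: eq_bigr => i _; rewrite !mxE; ring.
Qed.

Let Lfilter z := dirac_shifts_filter z.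
Let Lge0 (p : V * P2) := enorm_ge0 p.1.

Lemma Lexpands_cst c z : Lexpands (fun=> c) z 0.
Proof. exact: (lexp_cst (Lfilter z) Lge0 dot_linear_l). Qed.

Lemma LexpandsD h k z v w : Lexpands h z v -> Lexpands k z w ->
  Lexpands (fun mu => h mu + k mu) z (v + w).
Proof. exact: (lexpD (Lfilter z) dot_linear_l). Qed.

Lemma LexpandsZ c h z v : Lexpands h z v -> Lexpands (fun mu => c * h mu) z (c *: v).
Proof. exact: (lexpZ (Lfilter z) Lge0 dot_linear_l). Qed.

Lemma LexpandsM h k z v w : Lexpands h z v -> Lexpands k z w ->
  Lexpands (fun mu => h mu * k mu) z (h (dirac2 z) *: w + k (dirac2 z) *: v).
Proof. exact: (lexpM (Lfilter z) Lge0 (dirac_shifts_enorm z) dot_linear_l). Qed.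

Lemma slope_linear (x a : R) (u v : R^o) :
  (a *: u + v : R) * x = a * ((u : R) * x) + (v : R) * x.
Proof. by rewrite mulrDl -mulrA. Qed.

(** The relational form of the i-th component of opD: it carries the existence
    of both derivatives, as the calculus rules require. *)
Definition has_opD i f z (u : R) := exists a v,
  [/\ is_derive z (delta_mx i ord0 : V) (f ^~ (dirac2 z)) a,
      Lexpands (f z) z v & u = a + v i ord0].

Lemma has_opD_val i f z (u : R) : has_opD i f z u -> opD f z i ord0 = u.
Proof.
move=> [a [v [[_ da] Lv ->]]].
by rewrite /opD !mxE /partial da (Lexpands_Lderive Lv).
Qed.

Lemma opD_defined_has f z i : opD_defined f z -> has_opD i f z (opD f z i ord0).
Proof.
move=> [df Lf]; exists (partial i (f ^~ (dirac2 z)) z), (Lderive (f z) z); split.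
- by apply: derivableP; exact: df.
- exact: Ldifferentiable_Lexpands.
- by rewrite /opD !mxE.
Qed.

Lemma has_opD_derivable i f z (u : R) : has_opD i f z u ->
  derivable (f ^~ (dirac2 z)) z (delta_mx i ord0) /\ Ldifferentiable (f z) (dirac2 z).
Proof.
move=> [a [v [[da _] Lv _]]]; split=> //.
by exists (cst v); exact: Lexpands_is_Lderive.
Qed.

Lemma has_opD_ext i f g z (u : R) u' : (forall x mu, f x mu = g x mu) -> u = u' ->
  has_opD i f z u -> has_opD i g z u'.
Proof. by move=> fg <-; have -> : f = g by apply/funext => x; apply/funext => mu. Qed.

Lemma has_opD_cst i c z : has_opD i (fun _ _ => c) z 0.
Proof.
exists 0, 0; split; rewrite ?mxE ?addr0//; first exact: is_derive_cst.
exact: Lexpands_cst.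
Qed.

Lemma has_opDD i f g z (u u' : R) : has_opD i f z u -> has_opD i g z u' ->
  has_opD i (fun x mu => f x mu + g x mu) z (u + u').
Proof.
move=> [a [y [da Ly ->]]] [b [w [db Lw ->]]]; exists (a + b), (y + w); split.
- exact: is_deriveD.
- exact: LexpandsD.
- by rewrite mxE addrACA.
Qed.

Lemma has_opDZ i c f z (u : R) : has_opD i f z u ->
  has_opD i (fun x mu => c * f x mu) z (c * u).
Proof.
move=> [a [y [da Ly ->]]]; exists (c * a), (c *: y); split.
- exact: is_deriveZ.
- exact: LexpandsZ.
- by rewrite mxE mulrDr.
Qed.

Lemma has_opDN i f z (u : R) : has_opD i f z u -> has_opD i (fun x mu => - f x mu) z (- u).
Proof.
by move=> /(has_opDZ (-1)); apply: has_opD_ext => *; rewrite mulN1r.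
Qed.

Lemma has_opDB i f g z (u u' : R) : has_opD i f z u -> has_opD i g z u' ->
  has_opD i (fun x mu => f x mu - g x mu) z (u - u').
Proof. by move=> Hf /has_opDN; exact: has_opDD. Qed.

Lemma has_opDM i f g z (u u' : R) : has_opD i f z u -> has_opD i g z u' ->
  has_opD i (fun x mu => f x mu * g x mu) z
    (f z (dirac2 z) * u' + g z (dirac2 z) * u).
Proof.
move=> [a [y [da Ly ->]]] [b [w [db Lw ->]]].
exists (f z (dirac2 z) * b + g z (dirac2 z) * a).
exists (f z (dirac2 z) *: w + g z (dirac2 z) *: y); split.
- exact: is_deriveM.
- exact: LexpandsM.
- by rewrite !mxE; ring.
Qed.

Lemma has_opD_sum i n (f : 'I_n -> V -> P2 -> R) z (u : 'I_n -> R) :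
  (forall j, has_opD i (f j) z (u j)) ->
  has_opD i (fun x mu => \sum_j f j x mu) z (\sum_j u j).
Proof.
elim: n f u => [|n IH] f u H.
  by apply: has_opD_ext (has_opD_cst i 0 z) => *; rewrite big_ord0.
apply: has_opD_ext (has_opDD (H ord0) (IH _ _ (fun j => H (lift ord0 j)))) => *;
  by rewrite big_ord_recl.
Qed.

Lemma derivable_partial_expands (p : V -> R) z i :
  derivable p z (delta_mx i ord0) -> expands (0:R)^' (fun s => `|s|)
    (fun s => p (s *: delta_mx i ord0 + z)) (p z) (fun s => partial i p z * s).
Proof. by move=> /derivableP/is_derive_expandsP. Qed.

(** lexp_solve in the two directions x and mu. *)
Lemma opD_defined_solve n (S A : V -> P2 -> 'M[R]_n) (B : V -> P2 -> 'cV[R]_n) z :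
  (forall j l, {for z, continuous (fun x => S x (dirac2 z) j l)}) ->
  (forall j l, {for dirac2 z, continuous (fun mu => S z mu j l)}) ->
  (forall x mu, S x mu *m A x mu = 1%:M) ->
  (forall j l, opD_defined (fun x mu => A x mu j l) z) ->
  (forall j, opD_defined (fun x mu => (A x mu *m B x mu) j ord0) z) ->
  forall j, opD_defined (fun x mu => B x mu j ord0) z.
Proof.
move=> cSx cSm SA hA hc m; split=> [i|].
  have cS j l : S (s *: delta_mx i ord0 + z) (dirac2 z) j l @[s --> (0:R)^'] -->
      S z (dirac2 z) j l.
    suff c : s *: delta_mx i ord0 + z @[s --> (0:R)^'] --> z.
      exact: (cvg_comp _ _ c (cSx j l)).
    rewrite -[X in _ --> X]add0r -(scale0r (delta_mx i ord0 : V)).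
    apply: cvgD; last exact: cvg_cst.
    by apply: cvgZl; apply: nbhs_dnbhs.
  have H := @lexp_solve R R (0:R)^' (fun s => `|s|) _ (@normr_ge0 R R)
    R^o (fun u s : R => u * s) slope_linear n
    (fun s => S (s *: delta_mx i ord0 + z) (dirac2 z))
    (fun s => A (s *: delta_mx i ord0 + z) (dirac2 z))
    (fun s => B (s *: delta_mx i ord0 + z) (dirac2 z))
    (S z (dirac2 z)) (A z (dirac2 z)) (B z (dirac2 z))
    (fun j l => partial i (fun x => A x (dirac2 z) j l) z)
    (fun j => partial i (fun x => (A x (dirac2 z) *m B x (dirac2 z)) j ord0) z)
    cS _ (SA z (dirac2 z)) _ _ m.
  suff [a /(is_derive_expandsP (fun x : V => B x (dirac2 z) m ord0) z (delta_mx i ord0) a)[]] : exists a : R, expands (0:R)^' (fun s => `|s|)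
    (fun s => B (s *: delta_mx i ord0 + z) (dirac2 z) m ord0)
    (B z (dirac2 z) m ord0) (fun s => a * s) by [].
  eexists; apply: H.
  - by apply: nearW => x.
  - move=> j l; exact: (derivable_partial_expands ((hA j l).1 i)).
  - move=> j; exact: (derivable_partial_expands ((hc j).1 i)).
have cS j l : S z p.2 j l @[p --> dirac_shifts z] --> S z (dirac2 z) j l.
  exact: (cvg_comp _ _ (@dirac_shifts_cvg _ _ z) (cSm j l)).
have h := lexp_solve (Lfilter z) Lge0 dot_linear_l cS _ (SA z (dirac2 z)).
eexists; apply: Lexpands_is_Lderive.
apply: (h (fun p : V * P2 => A z p.2) (fun p : V * P2 => B z p.2) (B z (dirac2 z)) _ _ _ _ _ m).
- by apply: nearW => x.
- move=> j l; exact: Ldifferentiable_Lexpands (hA j l).2.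
- move=> j; exact: Ldifferentiable_Lexpands (hc j).2.
Qed.

End opD_calculus.

(** * Derivatives in time on a closed interval *)
Section matrix_convergence.
Variable R : realType.

Lemma cvg_entries (X : Type) (F : set_system X) (FF : Filter F) m n
    (f : X -> 'M[R]_(m, n)) (M : 'M[R]_(m, n)) :
  (forall i j, f x i j @[x --> F] --> M i j) -> f x @[x --> F] --> M.
Proof.
move=> fM A [P PM PA]; suff : \forall x \near F, forall i j, P i j (f x i j).
  by apply: filterS => x Px; exact: PA.
by apply: filter_forall => i; apply: filter_forall => j; exact: fM (PM i j).
Qed.

Lemma cvg_entry (X : Type) (F : set_system X) (FF : Filter F) m n
    (f : X -> 'M[R]_(m, n)) (M : 'M[R]_(m, n)) i j :
  f x @[x --> F] --> M -> f x i j @[x --> F] --> M i j.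
Proof. by move=> fM; exact: (cvg_comp _ _ fM (@coord_continuous R m n i j M)). Qed.

Lemma cvg_sum_ord (X : Type) (F : set_system X) (FF : Filter F) n
    (f : 'I_n -> X -> R) (a : 'I_n -> R) :
  (forall i, f i x @[x --> F] --> a i) -> \sum_i f i x @[x --> F] --> \sum_i a i.
Proof.
elim: n f a => [|n IH] f a fa.
  rewrite big_ord0 (_ : (fun x => _) = (fun=> 0)); first exact: cvg_cst.
  by apply/funext => x; rewrite big_ord0.
rewrite big_ord_recl (_ : (fun x => _) =
    (fun x => f ord0 x + \sum_i f (lift ord0 i) x)).
  by apply: cvgD; [exact: fa|exact: IH].
by apply/funext => x; rewrite big_ord_recl.
Qed.

End matrix_convergence.

Section time_calculus.
Variables (R : realType) (T : R).
Hypothesis T_gt0 : 0 < T.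
Implicit Types (f g : R -> R) (t : R).

Local Notation tnbhs' t := (within `[0, T] (dnbhs t)).
Local Notation tnbhs t := (within `[0, T] (nbhs t)).

Definition is_tderive f t (l : R) := diff_quot f t s @[s --> tnbhs' t] --> l.

(** Every point of [0, T] is an accumulation point of [0, T], as T > 0; hence
    one-sided limits at the end points are unique. *)
Lemma tnbhs'_proper t : t \in `[0, T] -> ProperFilter (tnbhs' t).
Proof.
rewrite in_itv/= => /andP[t0 tT].
apply: Build_ProperFilter_ex => A hA; rewrite /within/= in hA.
have {hA} [e /= e0 hA] := (nbhs_ballP _ _).1 hA.
have [tT'|tT'] := ltP t T.
  pose s := t + Num.min (e / 2) (T - t).
  have m0 : 0 < Num.min (e / 2) (T - t) by rewrite lt_min divr_gt0//= subr_gt0.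
  have m1 : Num.min (e / 2) (T - t) <= e / 2 by rewrite ge_min lexx.
  have m2 : Num.min (e / 2) (T - t) <= T - t by rewrite ge_min lexx orbT.
  exists s; apply: hA; rewrite /ball/= /s ?in_itv/=.
  - by rewrite ltr_distlC; lra.
  - by rewrite gt_eqF// ltrDl.
  - by lra.
pose s := t - Num.min (e / 2) t.
have m0 : 0 < Num.min (e / 2) t by rewrite lt_min divr_gt0//= (lt_le_trans T_gt0).
have m1 : Num.min (e / 2) t <= e / 2 by rewrite ge_min lexx.
have m2 : Num.min (e / 2) t <= t by rewrite ge_min lexx orbT.
exists s; apply: hA; rewrite /ball/= /s ?in_itv/=.
- by rewrite ltr_distlC; lra.
- by rewrite lt_eqF// ltrBlDr ltrDl.
- by lra.
Qed.

Lemma is_tderive_tderive f t l : t \in `[0, T] -> is_tderive f t l -> tderive T f t = l.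
Proof. by move=> /tnbhs'_proper tT fl; apply: cvg_lim. Qed.

Lemma is_tderive_tderivable f t l : is_tderive f t l -> tderivable T f t.
Proof. by move=> fl; apply/cvg_ex; exists l. Qed.

Lemma tderivableP f t : tderivable T f t -> is_tderive f t (tderive T f t).
Proof. by []. Qed.

Lemma tnbhs'_neq t : \forall s \near tnbhs' t, s - t != 0.
Proof.
by apply: cvg_within; near=> s; rewrite subr_eq0; near: s; exact: nbhs_dnbhs_neq.
Unshelve. all: by end_near. Qed.

Lemma is_tderive_expandsP f t l : is_tderive f t l <->
  expands (tnbhs' t) (fun s => `|s - t|) f (f t) (fun s => l * (s - t)).
Proof. by rewrite (expands_quotient _ (tnbhs'_neq t)). Qed.

Lemma tnbhs'_cvg0 t : `|s - t| @[s --> tnbhs' t] --> (0 : R).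
Proof.
apply: cvg_within_filter; apply/cvgr0Pnorm_lt => e e0; near=> s.
rewrite normr_id distrC; near: s; apply: nbhs_dnbhs; exact: nbhsx_ballx.
Unshelve. all: by end_near. Qed.

Let dist_ge0 t (s : R) : 0 <= `|s - t|. Proof. exact: normr_ge0. Qed.

Lemma is_tderive_cvg' f t l : is_tderive f t l -> f s @[s --> tnbhs' t] --> f t.
Proof.
by move=> /is_tderive_expandsP/(expands_cvg _ (dist_ge0 t) (tnbhs'_cvg0 t)).
Qed.

Lemma tcvg' (U : topologicalType) (f : R -> U) t :
  f s @[s --> tnbhs' t] --> f t -> f s @[s --> tnbhs t] --> f t.
Proof.
move=> h A fA; have := h A fA; rewrite !nbhs_simpl /= /dnbhs /within/= => H.
near=> s => sT.
have [->|st] := eqVneq s t; first exact: nbhs_singleton.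
by move: sT; move: st; near: s.
Unshelve. all: by end_near. Qed.

Lemma tderivable_within f : (forall t, t \in `[0, T] -> tderivable T f t) ->
  {within `[0, T], continuous f}.
Proof.
move=> df; apply/subspace_continuousP => t tT.
by apply: tcvg'; apply: is_tderive_cvg' (tderivableP (df _ _)).
Qed.

Lemma is_tderiveD f g t a b : is_tderive f t a -> is_tderive g t b ->
  is_tderive (fun s => f s + g s) t (a + b).
Proof.
move=> /is_tderive_expandsP ef /is_tderive_expandsP eg.
apply/is_tderive_expandsP; apply: expands_ext (expandsD _ ef eg) => // s.
by rewrite mulrDl.
Qed.

Lemma is_tderiveZ (c : R) f t a : is_tderive f t a -> is_tderive (fun s => c * f s) t (c * a).
Proof.
move=> /is_tderive_expandsP ef; apply/is_tderive_expandsP.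
by apply: expands_ext (expandsZ _ (dist_ge0 t) c ef) => // s; rewrite mulrA.
Qed.

Lemma is_tderiveM f g t a b : is_tderive f t a -> is_tderive g t b ->
  is_tderive (fun s => f s * g s) t (f t * b + g t * a).
Proof.
move=> /is_tderive_expandsP ef /is_tderive_expandsP eg; apply/is_tderive_expandsP.
apply: expands_ext (expandsM _ (dist_ge0 t) (tnbhs'_cvg0 t) ef eg) => // s.
by rewrite mulrDl !mulrA.
Qed.

Lemma is_tderive_cst (c t : R) : is_tderive (fun=> c) t 0.
Proof.
apply/is_tderive_expandsP; apply: expands_ext (expands_cst _ (dist_ge0 t) c) => // s.
by rewrite mul0r.
Qed.

Lemma is_tderive_sum n (f : 'I_n -> R -> R) t (a : 'I_n -> R) :
  (forall i, is_tderive (f i) t (a i)) ->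
  is_tderive (fun s => \sum_i f i s) t (\sum_i a i).
Proof.
move=> h; apply/is_tderive_expandsP.
apply: expands_ext (expands_sum _ (dist_ge0 t) (fun i => (is_tderive_expandsP _ _ _).1 (h i))) => // s.
by rewrite mulr_suml.
Qed.

Lemma is_tderive_eq f g t a : t \in `[0, T] -> (forall s, s \in `[0, T] -> f s = g s) ->
  is_tderive f t a -> is_tderive g t a.
Proof.
move=> tT fg; apply: cvg_trans; apply: near_eq_cvg; near=> s.
have sT : s \in `[0, T] by near: s; exact: withinT.
by rewrite /diff_quot !fg.
Unshelve. all: by end_near. Qed.

Lemma is_derive_is_tderive f t a : is_derive t (1 : R) f a -> is_tderive f t a.
Proof.
move=> /is_derive_expandsP[_ h]; apply/is_tderive_expandsP; split.
  by exists `|a|; apply: nearW => s; rewrite normrM.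
move=> e e0.
have h1 : \forall k \near (0:R), k != 0 -> `|f (k *: 1 + t) - f t - a * k| <= e * `|k|.
  exact: h.
have h2 : \forall s \near t, s - t != 0 -> `|f s - f t - a * (s - t)| <= e * `|s - t|.
  move: h1; rewrite (near_shift t); apply: filterS => s /=.
  by rewrite sub0r [_ *: 1]mulr1 subrK.
near=> s; have st : s - t != 0 by near: s; exact: tnbhs'_neq.
by move: st; near: s; apply: cvg_within; apply: nbhs_dnbhs.
Unshelve. all: by end_near. Qed.

End time_calculus.

(** * Continuity on a compact time interval *)
Section clamp.
Variables (R : realType) (T : R).
Hypothesis T_ge0 : 0 <= T.

(** Projection of R onto [0, T]; composing with it extends a continuous function
    on [0, T] to R, after which derivatives at 0 and T are two-sided. *)
Definition clamp (t : R) : R := Num.max 0 (Num.min T t).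

Lemma clamp_itv t : clamp t \in `[0, T].
Proof. by rewrite in_itv/= /clamp le_max lexx/= ge_max T_ge0 ge_min lexx. Qed.

Lemma clamp_id t : t \in `[0, T] -> clamp t = t.
Proof.
by rewrite in_itv/= => /andP[t0 tT]; rewrite /clamp (min_idPr tT) (max_idPr t0).
Qed.

Lemma clamp_dist s t : `|clamp s - clamp t| <= `|s - t|.
Proof.
have N1 := ler_norm (s - t).
have N2 : - (s - t) <= `|s - t| by rewrite -normrN ler_norm.
have N3 := normr_ge0 (s - t).
rewrite /clamp ler_norml; have := T_ge0.
case: (leP T s) => hs; case: (leP T t) => ht T0; rewrite ?(max_r T0).
- by lra.
- by case: (leP 0 t) => h; lra.
- by case: (leP 0 s) => h; lra.
- by case: (leP 0 t) => h; case: (leP 0 s) => k; lra.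
Qed.

Lemma continuous_clamp (f : R -> R) : {within `[0, T], continuous f} ->
  forall t, {for t, continuous (f \o clamp)}.
Proof.
move=> /subspace_continuousP cf t.
have h : clamp s @[s --> t] --> within `[0, T] (nbhs (clamp t)).
  move=> A hA.
  suff c : clamp s @[s --> t] --> clamp t.
    have := c [set y | y \in `[0, T] -> A y] hA; rewrite !nbhs_simpl/=.
    by apply: filterS => s; apply; exact: clamp_itv.
  apply/cvgrPdist_le => e e0; near=> s; apply: (le_trans (clamp_dist _ _)).
  near: s; exact: (@cvgr_dist_le _ _ _ _ _ id t).
exact: (cvg_comp _ _ h (cf _ (clamp_itv t))).
Unshelve. all: by end_near. Qed.

End clamp.

Section uniform_perturbation.
Variables (R : realType) (T : R) (d : nat).
Local Notation V := 'cV[R]_d.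
Local Notation Q := (R * V * V * V)%type.

Lemma continuous_along (X : topologicalType) (F : set_system X) (FF : Filter F)
  (G : Q -> R) (a : X -> R) (x v z : X -> V) t0 x0 v0 z0 :
  {within [set q : Q | q.1.1.1 \in `[0, T]], continuous G} ->
  t0 \in `[0, T] -> (\forall y \near F, a y \in `[0, T]) ->
  a y @[y --> F] --> t0 -> x y @[y --> F] --> x0 ->
  v y @[y --> F] --> v0 -> z y @[y --> F] --> z0 ->
  G (a y, x y, v y, z y) @[y --> F] --> G (t0, x0, v0, z0).
Proof.
move=> /subspace_continuousP cG tT aT ca cx cv cz.
have h : (a y, x y, v y, z y) @[y --> F] -->
   within [set q : Q | q.1.1.1 \in `[0, T]] (nbhs (t0, x0, v0, z0)).
  move=> A hA.
  have c : (a y, x y, v y, z y) @[y --> F] --> (t0, x0, v0, z0).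
    exact: (@cvg_pair _ _ _ F (nbhs (t0, x0, v0)) (nbhs z0) _ _ _
      (fun y => (a y, x y, v y)) z (@cvg_pair _ _ _ F (nbhs (t0, x0)) (nbhs v0) _ _ _
      (fun y => (a y, x y)) v (@cvg_pair _ _ _ F (nbhs t0) (nbhs x0) _ _ _
       a x ca cx) cv) cz).
  have := c [set q : Q | q.1.1.1 \in `[0, T] -> A q] hA; rewrite !nbhs_simpl/= => H; near=> y.
  have yT : a y \in `[0, T] by near: y.
  by move: yT; near: y.
exact: (cvg_comp _ _ h (cG (t0, x0, v0, z0) tT)).
Unshelve. all: by end_near. Qed.

(** Uniformity in t comes from the compactness of [0, T]: at each t0 the claim
    holds for t near t0 and small a, b, c, and finitely many t0 suffice. *)
Lemma uniform_perturbation (G : Q -> R) (phi psi : R -> V) (w : V) :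
  {within [set q : Q | q.1.1.1 \in `[0, T]], continuous G} ->
  {within `[0, T], continuous phi} -> {within `[0, T], continuous psi} ->
  forall e : R, 0 < e -> exists2 r : R, 0 < r &
    forall t a b c, t \in `[0, T] -> `|a| < r -> `|b| < r -> `|c| < r ->
    `|G (t, phi t + a *: w, psi t + b *: w, phi t + c *: w)
      - G (t, phi t, psi t, phi t)| <= e.
Proof.
move=> cG /subspace_continuousP cphi /subspace_continuousP cpsi e e0.
pose P (y : R * R * R) (t : R) :=
  `|G (t, phi t + y.1.1 *: w, psi t + y.1.2 *: w, phi t + y.2 *: w)
      - G (t, phi t, psi t, phi t)| <= e.
have cT : compact `[0, T] by exact: segment_compact.
have NC := (near_covering_withinP _).2 ((compact_near_coveringP _).1 cT).
suff H t : t \in `[0, T] -> \forall t' \near t & y \near (nbhs (0, 0, 0) : set_system (R * R * R)%type),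
    t' \in `[0, T] -> P y t'.
  have K := NC _ (nbhs (0, 0, 0) : set_system (R * R * R)%type) P (nbhs_filter _) H.
  have [r /= r0 B] := (nbhs_ballP _ _).1 K; exists r => // s a b c sT ar br cr.
  apply: (B (a, b, c)) => //.
  by split; [split|]; rewrite /ball/= sub0r normrN.
move=> tT.
  pose W := within `[0, T] (nbhs t).
  pose I0 := nbhs (0, 0, 0) : set_system (R * R * R)%type.
  pose FP := filter_prod W I0.
  have FF : Filter FP by exact: filter_prod_filter.
  have cf1 : p.1 @[p --> FP] --> W by exact: cvg_fst.
  have cf2 : p.2 @[p --> FP] --> I0 by exact: cvg_snd.
  have I1 : p.1.1 @[p --> I0] --> (0 : R) by exact: (cvg_comp _ _ cvg_fst cvg_fst).
  have I2 : p.1.2 @[p --> I0] --> (0 : R) by exact: (cvg_comp _ _ cvg_fst cvg_snd).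
  have I3 : p.2 @[p --> I0] --> (0 : R) by exact: cvg_snd.
  have ct : p.1 @[p --> FP] --> t by apply: cvg_trans cf1 _; exact: cvg_within.
  have cp : phi p.1 @[p --> FP] --> phi t by exact: (cvg_comp _ _ cf1 (cphi _ tT)).
  have cs : psi p.1 @[p --> FP] --> psi t by exact: (cvg_comp _ _ cf1 (cpsi _ tT)).
  have inT : \forall p \near FP, p.1 \in `[0, T].
    exact: (cf1 _ (withinT _ _)).
  have pert (x : V) (f : R -> V) (k : R * R * R -> R) : k p @[p --> I0] --> (0 : R) ->
      f p.1 @[p --> FP] --> x -> f p.1 + k p.2 *: w @[p --> FP] --> x.
    move=> ck cf; rewrite -[X in _ --> X]addr0 -(scale0r w).
    by apply: cvgD => //; apply: cvgZl; exact: (cvg_comp _ _ cf2 ck).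
  have c1 := continuous_along FF cG tT inT ct (pert _ _ _ I1 cp) (pert _ _ _ I2 cs) (pert _ _ _ I3 cp).
  have c2 := continuous_along FF cG tT inT ct cp cs cp.
  have e2 : 0 < e / 2 by rewrite divr_gt0.
  have : \forall p \near FP, P p.2 p.1.
    near=> p; rewrite /P.
    have h1 : `|G (t, phi t, psi t, phi t) - G (p.1, phi p.1 + p.2.1.1 *: w, psi p.1 + p.2.1.2 *: w, phi p.1 + p.2.2 *: w)| <= e / 2.
      by near: p; move/cvgrPdist_le: c1; apply.
    have h2 : `|G (t, phi t, psi t, phi t) - G (p.1, phi p.1, psi p.1, phi p.1)| <= e / 2.
      by near: p; move/cvgrPdist_le: c2; apply.
    rewrite distrC in h1.
    rewrite [e]splitr (le_trans _ (lerD h1 h2))//.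
    by rewrite (le_trans _ (ler_normD _ _))// addrA subrK.
  move=> [[A B] [/= hA hB] AB].
  exists ([set s | s \in `[0, T] -> A s], B) => // -[s y] [/= sA By] sT.
  by apply: (AB (s, y)); split=> //; exact: sA.
Unshelve. all: by end_near. Qed.
End uniform_perturbation.

(** * The Euler-Lagrange equation *)
Section first_variation.
Variables (R : realType) (T : R) (d : nat).
Local Notation V := 'cV[R]_d.
Local Notation P2 := (P2 R d).
Local Notation Q := (R * V * V * V)%type.
Variable L : R -> V -> V -> P2 -> R.
Hypothesis T_gt0 : 0 < T.
Hypothesis hB : regularity_B T L.
Local Notation mu := (@lebesgue_measure R).
Local Notation e_ i := (delta_mx i ord0 : V).

Definition Lx i (q : Q) : R :=
  partial i (fun x => L q.1.1.1 x q.1.2 (dirac2 q.2)) q.1.1.2.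
Definition Lv i (q : Q) : R :=
  partial i (fun v => L q.1.1.1 q.1.1.2 v (dirac2 q.2)) q.1.2.
Definition Lmu i (q : Q) : R := Lderive (L q.1.1.1 q.1.1.2 q.1.2) q.2 i ord0.

Let D := [set q : Q | q.1.1.1 \in `[0, T]].

Let continuous_coordinate (G : Q -> V) (g : Q -> R) i : (forall q, g q = G q i ord0) ->
  {within D, continuous G} -> {within D, continuous g}.
Proof.
move=> /funext -> /subspace_continuousP cG; apply/subspace_continuousP => q Dq.
exact: (cvg_entry _ (cG q Dq)).
Qed.

Lemma continuous_Lx i : {within D, continuous (Lx i)}.
Proof. by apply: continuous_coordinate (B_cont_x hB) => q; rewrite mxE. Qed.

Lemma continuous_Lv i : {within D, continuous (Lv i)}.
Proof. by apply: continuous_coordinate (B_cont_v hB) => q; rewrite mxE. Qed.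

Lemma continuous_Lmu i : {within D, continuous (Lmu i)}.
Proof. by apply: continuous_coordinate (B_cont_mu hB) => q. Qed.

Let differentiable_direction (f : V -> R) y (w : V) : differentiable f y ->
  is_derive y w f (\sum_i partial i f y * w i ord0).
Proof.
move=> df; have := derivableP (diff_derivable (v := w) df).
rewrite deriveE// [w in 'd f y w](_ : _ = \sum_i w i ord0 *: e_ i).
  rewrite linear_sum /=; congr is_derive; apply: eq_bigr => i _.
  by rewrite linearZ /= mulrC -deriveE.
apply/matrixP => k l; rewrite [l]ord1 summxE (bigD1 k)//= !mxE !eqxx mulr1.
by rewrite big1 ?addr0// => i ik; rewrite !mxE eq_sym (negbTE ik) mulr0.
Qed.

(** The next three lemmas are the mean value theorem in x, in v and in the
    measure; the last one rests on Lexpands_derivative. *)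
Lemma increment_x t x v z (w : V) : t \in `[0, T] -> exists2 s : R, 0 <= s <= 1 &
  L t (x + w) v (dirac2 z) - L t x v (dirac2 z) =
  \sum_i Lx i (t, x + s *: w, v, z) * w i ord0.
Proof.
move=> tT; have [dL _] := B_C1_x hB v (dirac2 z) tT.
exact: (@mvt_direction _ _ (fun x => L t x v (dirac2 z))
  (fun y => \sum_i Lx i (t, y, v, z) * w i ord0) x w
  (fun s => differentiable_direction w (dL _))).
Qed.

Lemma increment_v t x v z (w : V) : t \in `[0, T] -> exists2 s : R, 0 <= s <= 1 &
  L t x (v + w) (dirac2 z) - L t x v (dirac2 z) =
  \sum_i Lv i (t, x, v + s *: w, z) * w i ord0.
Proof.
move=> tT; have [dL _] := B_C1_v hB x (dirac2 z) tT.
exact: (@mvt_direction _ _ (fun v => L t x v (dirac2 z))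
  (fun y => \sum_i Lv i (t, x, y, z) * w i ord0) v w
  (fun s => differentiable_direction w (dL _))).
Qed.

Lemma increment_mu t x v z (w : V) : t \in `[0, T] -> exists2 s : R, 0 <= s <= 1 &
  L t x v (dirac2 (z + w)) - L t x v (dirac2 z) =
  \sum_i Lmu i (t, x, v, z + s *: w) * w i ord0.
Proof.
move=> tT.
have [s s01 E] := @mvt_direction _ _ (L t x v \o @dirac2 R d)
  (fun y => dot (Lderive (L t x v) y) w) z w
  (fun s => Lexpands_derivative w (Ldifferentiable_Lexpands (B_Ldiff hB x v _ tT))).
by exists s => //; rewrite [LHS]E dotE.
Qed.

Let sum_delta (g : 'I_d -> R) i (a : R) : \sum_j g j * (a *: e_ i) j ord0 = a * g i.
Proof.
rewrite (bigD1 i)//= !mxE !eqxx mulr1 mulrC big1 ?addr0// => j ji.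
by rewrite !mxE (negbTE ji) !mulr0.
Qed.

Section along_a_path.
Variable phi : R -> V.
Hypothesis hphi : C2_path T phi.
Let psi := mtderive T phi.

Lemma is_tderive_path i t : t \in `[0, T] ->
  is_tderive T (fun s => phi s i ord0) t (psi t i ord0).
Proof.
by move=> tT; rewrite /psi mxE; apply: tderivableP; exact: (hphi i).1.1.
Qed.

Lemma is_tderive_velocity i t : t \in `[0, T] ->
  is_tderive T (fun s => psi s i ord0) t (mtderive T psi t i ord0).
Proof.
by move=> tT; rewrite [in X in is_tderive _ _ _ X]mxE; apply: tderivableP; exact: (hphi i).2.1.
Qed.

Let within_entries (f : R -> V) :
  (forall i, {within `[0, T], continuous (fun t => f t i ord0)}) ->
  {within `[0, T], continuous f}.
Proof.
move=> cf; apply/subspace_continuousP => t tT; apply: cvg_entries => i j.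
by rewrite [j]ord1; have /subspace_continuousP := cf i; exact.
Qed.

Lemma continuous_path : {within `[0, T], continuous phi}.
Proof.
apply: within_entries => i; apply: tderivable_within => t tT.
exact: (hphi i).1.1.
Qed.

Lemma continuous_velocity : {within `[0, T], continuous psi}.
Proof.
apply: within_entries => i; apply: tderivable_within => t tT.
exact: (hphi i).2.1.
Qed.

Let lift t : Q := (t, phi t, psi t, phi t).

Definition momentum i t := Lv i (lift t).
Definition force i t := Lx i (lift t) + Lmu i (lift t).

Let continuous_lift (G : Q -> R) :
  {within D, continuous G} -> {within `[0, T], continuous (G \o lift)}.
Proof.
move=> cG; apply/subspace_continuousP => t tT.
have /subspace_continuousP cphi := continuous_path.
have /subspace_continuousP cpsi := continuous_velocity.
apply: (continuous_along _ cG tT); [|exact: cvg_within|exact: cphi|exact: cpsi|exact: cphi].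
exact: withinT.
Qed.

Lemma continuous_momentum i : {within `[0, T], continuous (momentum i)}.
Proof. exact: (continuous_lift (@continuous_Lv i)). Qed.

Lemma continuous_force i : {within `[0, T], continuous (force i)}.
Proof.
have cx := continuous_lift (@continuous_Lx i); have cm := continuous_lift (@continuous_Lmu i).
by move=> t; apply: cvgD; [exact: cx|exact: cm].
Qed.

(** The increment of L is split into one increment in x, one in v and one in mu;
    uniform_perturbation replaces the intermediate gradients that the mean value
    theorem produces by the gradients on the path. *)
Lemma uniform_expansion i (th th' : R -> R) (M : R) : 0 < M ->
  (forall t, t \in `[0, T] -> `|th t| <= M /\ `|th' t| <= M) ->
  forall e, 0 < e -> exists2 r, 0 < r & forall h t, `|h| < r -> t \in `[0, T] ->
  `|L t (phi t + (h * th t) *: e_ i) (psi t + (h * th' t) *: e_ i)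
        (dirac2 (phi t + (h * th t) *: e_ i))
    - L t (phi t) (psi t) (dirac2 (phi t))
    - h * (force i t * th t + momentum i t * th' t)| <= `|h| * e.
Proof.
move=> M0 thM e e0.
have e3 : 0 < e / (3 * M) by rewrite divr_gt0// mulr_gt0.
have U (G : Q -> R) (cG : {within D, continuous G}) :=
  uniform_perturbation (e_ i) cG continuous_path continuous_velocity e3.
have [r1 r10 U1] := U _ (@continuous_Lx i).
have [r2 r20 U2] := U _ (@continuous_Lv i).
have [r3 r30 U3] := U _ (@continuous_Lmu i).
pose r := Num.min r1 (Num.min r2 r3).
have r0 : 0 < r by rewrite !lt_min r10 r20.
exists (r / M); first by rewrite divr_gt0.
move=> h t; rewrite ltr_pdivlMr// => hr tT.
have [thM1 thM2] := thM t tT.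
have small s (x : R) : 0 <= s <= 1 -> `|x| <= M -> `|s * (h * x)| < r.
  move=> /andP[s0 s1] xM; apply: le_lt_trans hr.
  rewrite !normrM (ger0_norm s0) -[leRHS]mul1r ler_pM//.
  by rewrite ler_wpM2l.
have one : 0 <= (1 : R) <= 1 by rewrite ler01 lexx.
have zero : `|0 : R| < r by rewrite normr0.
have [s1 s101 E1] := increment_x (phi t) (psi t + (h * th' t) *: e_ i)
  (phi t + (h * th t) *: e_ i) ((h * th t) *: e_ i) tT.
have [s2 s201 E2] := increment_v (phi t) (psi t) (phi t + (h * th t) *: e_ i) ((h * th' t) *: e_ i) tT.
have [s3 s301 E3] := increment_mu (phi t) (psi t) (phi t) ((h * th t) *: e_ i) tT.
rewrite sum_delta scalerA in E1; rewrite sum_delta scalerA in E2.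
rewrite sum_delta scalerA in E3.
have rr (a : R) : `|a| < r -> [/\ `|a| < r1, `|a| < r2 & `|a| < r3].
  by rewrite !lt_min => /andP[-> /andP[-> ->]].
have [x1 _ _] := rr _ (small _ _ s101 thM1).
have [x2 v2 m2] := rr _ (small _ _ one thM1).
have [x3 v3 m3] := rr _ (small _ _ one thM2).
have [_ v4 _] := rr _ (small _ _ s201 thM2).
have [_ _ m5] := rr _ (small _ _ s301 thM1).
have [z1 z2 z3] := rr _ zero.
rewrite !mul1r in x2 v2 m2 x3 v3 m3.
have F1 := U1 t _ _ _ tT x1 x3 x2.
have F2 := U2 t _ _ _ tT z2 v4 v2.
have F3 := U3 t _ _ _ tT z3 z3 m5.
rewrite !scale0r !addr0 in F2 F3.
set A1 := Lx i _ in E1 F1; set A2 := Lv i _ in E2 F2; set A3 := Lmu i _ in E3 F3.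
have -> : L t (phi t + (h * th t) *: e_ i) (psi t + (h * th' t) *: e_ i)
        (dirac2 (phi t + (h * th t) *: e_ i))
    - L t (phi t) (psi t) (dirac2 (phi t))
    - h * (force i t * th t + momentum i t * th' t) =
   h * ((A1 - Lx i (lift t)) * th t + (A2 - Lv i (lift t)) * th' t +
        (A3 - Lmu i (lift t)) * th t).
  rewrite /force /momentum.
  transitivity (h * th t * A1 + h * th' t * A2 + h * th t * A3
    - h * ((Lx i (lift t) + Lmu i (lift t)) * th t + Lv i (lift t) * th' t)); last by ring.
  by rewrite -E1 -E2 -E3; ring.
rewrite normrM ler_wpM2l//.
have -> : e = e / (3 * M) * M + e / (3 * M) * M + e / (3 * M) * M.
  by field; rewrite gt_eqF.
rewrite (le_trans (ler_normD _ _))// lerD//; last by rewrite normrM ler_pM.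
by rewrite (le_trans (ler_normD _ _))// lerD// normrM ler_pM.
Qed.

(** Chain rule along the path with the velocity argument frozen.  Both values are
    taken at the same time s, because L may fail to be differentiable in its
    first argument: only its gradients are continuous in it. *)
Lemma path_increment v t : t \in `[0, T] ->
  is_tderive T (fun s => L s (phi s) v (dirac2 (phi s)) - L s (phi t) v (dirac2 (phi t)))
    t (\sum_i (Lx i (t, phi t, v, phi t) + Lmu i (t, phi t, v, phi t)) * psi t i ord0).
Proof.
move=> tT; pose z := phi t; pose w s := phi s - z.
have /choice[a ha] s : exists a : R * R, s \in `[0, T] ->
   [/\ 0 <= a.1 <= 1, 0 <= a.2 <= 1 &
   L s (phi s) v (dirac2 (phi s)) - L s z v (dirac2 z) =
   \sum_i Lx i (s, z + a.1 *: w s, v, phi s) * w s i ord0 +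
   \sum_i Lmu i (s, z, v, z + a.2 *: w s) * w s i ord0].
  have [sT|] := boolP (s \in `[0, T]); last by exists (0, 0).
  have [a1 a101 E1] := increment_x z v (phi s) (w s) sT.
  have [a2 a201 E2] := increment_mu z v z (w s) sT.
  have zw : z + w s = phi s by rewrite /w addrC subrK.
  by exists (a1, a2) => _; split=> //=; rewrite -E1 -E2 zw; ring.
pose F := within `[0, T] (dnbhs t).
have FF : ProperFilter F by exact: tnbhs'_proper.
have FT : \forall s \near F, s \in `[0, T] by exact: withinT.
have ct : s @[s --> F] --> t.
  by apply: cvg_within_filter; exact: nbhs_dnbhs.
have cphi : phi s @[s --> F] --> z.
  apply: cvg_entries => i j; rewrite [j]ord1.
  exact: is_tderive_cvg' (@is_tderive_path i t tT).
have cw (f : R -> R) : (\forall s \near F, 0 <= f s <= 1) ->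
    z + f s *: w s @[s --> F] --> z.
  move=> f01; rewrite -[X in _ --> X]addr0; apply: cvgD; first exact: cvg_cst.
  apply: cvg_entries => i j; rewrite [j]ord1 [X in _ --> X]mxE.
  have wi : w s i ord0 @[s --> F] --> (0 : R).
    rewrite -(subrr (z i ord0)).
    rewrite (_ : (fun s => w s i ord0) = (fun s => phi s i ord0 - z i ord0)).
      by apply: cvgB; [exact: cvg_entry|exact: cvg_cst].
    by apply/funext => s; rewrite /w !mxE.
  apply/cvgr0Pnorm_le => e e0.
  have /cvgr0Pnorm_le/(_ e e0) we := wi.
  near=> s; have /andP[f0 f1] : 0 <= f s <= 1 by near: s.
  rewrite mxE normrM (ger0_norm f0) (le_trans (ler_piMl _ f1))//.
  by near: s.
rewrite /is_tderive.
pose q i s := w s i ord0 / (s - t).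
have cq i : q i s @[s --> F] --> psi t i ord0.
  have := @is_tderive_path i t tT; rewrite /is_tderive.
  apply: cvg_trans; apply: near_eq_cvg; near=> s.
  by rewrite /q /w !mxE /diff_quot.
have cx i : Lx i (s, z + (a s).1 *: w s, v, phi s) @[s --> F] --> Lx i (t, z, v, z).
  apply: (continuous_along _ (@continuous_Lx i) tT FT ct) => //; last exact: cvg_cst.
  apply: cw; near=> s; have sT : s \in `[0, T] by near: s.
  by have [] := ha s sT.
have cm i : Lmu i (s, z, v, z + (a s).2 *: w s) @[s --> F] --> Lmu i (t, z, v, z).
  apply: (continuous_along _ (@continuous_Lmu i) tT FT ct); [exact: cvg_cst|exact: cvg_cst|].
  apply: cw; near=> s; have sT : s \in `[0, T] by near: s.
  by have [] := ha s sT.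
have : \sum_i (Lx i (s, z + (a s).1 *: w s, v, phi s) + Lmu i (s, z, v, z + (a s).2 *: w s)) * q i s
    @[s --> F] --> \sum_i (Lx i (t, z, v, z) + Lmu i (t, z, v, z)) * psi t i ord0.
  apply: cvg_sum_ord => i; apply: cvgM; last exact: cq.
  by apply: cvgD; [exact: cx|exact: cm].
apply: cvg_trans; apply: near_eq_cvg; near=> s.
have [_ _ E] : [/\ 0 <= (a s).1 <= 1, 0 <= (a s).2 <= 1 &
   L s (phi s) v (dirac2 (phi s)) - L s z v (dirac2 z) =
   \sum_i Lx i (s, z + (a s).1 *: w s, v, phi s) * w s i ord0 +
   \sum_i Lmu i (s, z, v, z + (a s).2 *: w s) * w s i ord0] by apply: ha; near: s.
rewrite /diff_quot E subrr subr0 -big_split mulr_suml /=; apply: eq_bigr => i _.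
by rewrite -mulrDl /q mulrA.
Unshelve. all: by end_near. Qed.

Let smooth_scale (th : R -> R) c : smooth th -> smooth (fun s => th s * c).
Proof.
move=> sth; apply: (@smooth_class _ [set f | exists2 g : R -> R, smooth g & f = (fun s => g s * c)]).
  move=> _ [g sg ->].
  have dg x : is_derive x (1 : R) (fun s => g s * c) (g^`()%classic x * c).
    have dm := is_deriveM (smooth_is_derive x sg) (is_derive_cst c x (1 : R)).
    by apply: (is_derive_eq dm); rewrite scaler0 add0r [_ *: _]mulrC.
  split=> [x|]; first by case: (dg x).
  exists g^`()%classic; first exact: smooth_derive1.
  by apply/funext => x; exact: is_derive_derive1 (dg x).
by exists th.
Qed.

Let continuous_bounded (f : R -> R) : {within `[0, T], continuous f} ->
  exists2 M : R, 0 < M & forall t, t \in `[0, T] -> `|f t| <= M.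
Proof.
move=> cf; have [|c _ fc] := @EVT_max R (fun t => `|f t|) 0 T (ltW T_gt0).
  by move=> t; apply: cvg_norm; exact: cf.
exists (`|f c| + 1); first by rewrite ltr_wpDl.
by move=> t /fc /le_trans; apply; rewrite lerDl.
Qed.

Let mtderive_variation i (th : R -> R) h t : smooth th -> t \in `[0, T] ->
  mtderive T (fun s => phi s + h *: (th s *: e_ i)) t =
  psi t + (h * th^`()%classic t) *: e_ i.
Proof.
move=> sth tT; apply/matrixP => j k; rewrite [k]ord1 mxE.
apply: (is_tderive_tderive T_gt0) => //.
have dm := is_derive_is_tderive T (smooth_is_derive t sth).
have := is_tderiveD (@is_tderive_path j t tT) (is_tderiveZ (c := h * e_ i j ord0) dm).
rewrite (_ : (fun s => phi s j ord0 + _) =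
    (fun s => (phi s + h *: (th s *: e_ i)) j ord0)).
  rewrite (_ : psi t j ord0 + _ = (psi t + (h * th^`()%classic t) *: e_ i) j ord0) //.
  have sE (c : R) (u : V) : (c *: u) j ord0 = c * u j ord0 by rewrite mxE.
  have dE (u v : V) : (u + v) j ord0 = u j ord0 + v j ord0 by rewrite mxE.
  by rewrite dE sE; ring.
by apply/funext => s; rewrite !mxE; ring.
Qed.

Hypothesis hcrit : critical_point T L phi.

(** The difference quotient of the action at 0 tends to 0 since phi is critical,
    and to the integral on the left by uniform_expansion. *)
Lemma weak_euler_lagrange i th : smooth th ->
  (exists a c, [/\ 0 < a, c < T & forall t, t \notin `[a, c] -> th t = 0]) ->
  \int[mu]_(t in `[0, T]) (force i t * th t + momentum i t * th^`()%classic t) = 0.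
Proof.
move=> sth supp; pose eta t := th t *: e_ i; pose th' := th^`()%classic.
have [] := hcrit (eta := eta).
  split.
    move=> j n t; rewrite (_ : (fun s => _) = (fun s => th s * e_ i j ord0)).
      exact: smooth_scale.
    by apply/funext => s; rewrite mxE.
  have [a [c [a0 cT th0]]] := supp; exists a, c; split=> // t /th0 tt.
  by rewrite /eta tt scale0r.
set A := fun e => action T L _; move=> int [dA dA0].
have cth : {within `[0, T], continuous th}.
  by apply: within_continuous_segment => x _; exact: is_derive_continuous (smooth_is_derive x sth).
have cth' : {within `[0, T], continuous th'}.
  apply: within_continuous_segment => x _.
  exact: is_derive_continuous (smooth_is_derive x (smooth_derive1 sth)).
have [M1 M10 HM1] := continuous_bounded cth.
have [M2 M20 HM2] := continuous_bounded cth'.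
have HM t : t \in `[0, T] -> `|th t| <= M1 + M2 /\ `|th' t| <= M1 + M2.
  move=> tT; split; first by rewrite (le_trans (HM1 t tT))// lerDl ltW.
  by rewrite (le_trans (HM2 t tT))// lerDr ltW.
have M0 : 0 < M1 + M2 by rewrite addr_gt0.
pose g t := force i t * th t + momentum i t * th' t.
have cg : {within `[0, T], continuous g}.
  have cf := @continuous_force i; have cm := @continuous_momentum i.
  move=> t; apply: cvgD; apply: cvgM; [exact: cf|exact: cth|exact: cm|exact: cth'].
have ig : mu.-integrable `[0, T] (EFin \o g) by exact: segment_integrable.
pose along_e h t := along T L (fun t => phi t + h *: eta t) t.
have alongE h t : t \in `[0, T] -> along_e h t =
    L t (phi t + (h * th t) *: e_ i) (psi t + (h * th' t) *: e_ i)
        (dirac2 (phi t + (h * th t) *: e_ i)).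
  by move=> tT; rewrite /along_e /along mtderive_variation// scalerA.
have i0 : mu.-integrable `[0, T] (EFin \o along_e 0) by exact: (nbhs_singleton int).
have cA : h^-1 *: (A (h *: 1 + 0) - A 0) @[h --> (0:R)^'] --> \int[mu]_(t in `[0, T]) g t.
  apply/cvgrPdist_le => e e0.
  have eT : 0 < e / T by rewrite divr_gt0.
  have [r r0 H] := uniform_expansion i M0 HM eT.
  near=> h.
  have h0 : h != 0 by near: h; exact: nbhs_dnbhs_neq.
  have hr : `|h| < r by near: h; exact: dnbhs0_lt.
  have ih : mu.-integrable `[0, T] (EFin \o along_e h) by near: h; exact: nbhs_dnbhs.
  rewrite addr0 [h *: 1]mulr1 distrC.
  rewrite -(ler_pM2r (_ : 0 < `|h|)) ?normr_gt0// -normrM mulrBl.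
  rewrite -[_ *: _ * h]/(h^-1 * _ * h) mulrAC mulVf// mul1r (mulrC _ h).
  have -> : A h = \int[mu]_(t in `[0, T]) along_e h t by [].
  have -> : A 0 = \int[mu]_(t in `[0, T]) along_e 0 t by [].
  have ihg : mu.-integrable `[0, T] (EFin \o (fun t => h * g t)).
    apply: segment_integrable => t; apply: cvgM; [exact: cvg_cst|exact: cg].
  have id : mu.-integrable `[0, T] (EFin \o (fun t => along_e h t - along_e 0 t)).
    exact: (integrableB _ ih i0).
  have idd : mu.-integrable `[0, T] (EFin \o (fun t => along_e h t - along_e 0 t - h * g t)).
    exact: (integrableB _ id ihg).
  rewrite -RintegralB// -RintegralZl// -RintegralB//.
  apply: (le_trans (le_normr_Rintegral _ idd)) => //.
  apply: (@le_trans _ _ (\int[mu]_(t in `[0, T]) (cst (`|h| * (e / T)) t))).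
    apply: le_Rintegral => //.
    - exact: (integrable_norm idd).
    - by apply: segment_integrable => t; exact: cvg_cst.
    - move=> t tT; rewrite !alongE// !mul0r !scale0r !addr0.
      exact: H.
  have muT : fine (mu `[0, T]%classic) = T.
    by rewrite lebesgue_measure_itv/= lte_fin T_gt0 sube0.
  rewrite Rintegral_cst// [X in fine X](_ : _ = mu `[0, T]%classic)// muT.
  by rewrite -mulrA divfK ?gt_eqF// mulrC.
have /is_derive_cvgP cA0 : is_derive (0 : R) 1 A 0 by split.
by have := cvg_unique _ cA cA0; apply.
Unshelve. all: by end_near. Qed.

(** By du_bois_reymond the momentum is a constant plus a primitive of the force. *)
Theorem euler_lagrange i t : t \in `[0, T] -> is_tderive T (momentum i) t (force i t).
Proof.
move=> tT.
have T0 := ltW T_gt0.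
pose p := momentum i \o clamp T; pose q := force i \o clamp T.
have cp (x : R) : {for x, continuous p} by exact: (continuous_clamp T0 (@continuous_momentum i)).
have cq (x : R) : {for x, continuous q} by exact: (continuous_clamp T0 (@continuous_force i)).
(* the lower bound -1 makes P two-sidedly derivable at 0 *)
pose P (x : R) := \int[mu]_(s in `[(-1)%R, x]) q s.
have dP (x : R) : 0 <= x -> is_derive x (1 : R) P (q x).
  by move=> x0; apply: is_derive_primitive => //; rewrite (lt_le_trans _ x0)// ltrN10.
have H th : smooth th ->
    (exists a c, [/\ 0 < a, c < T & forall t, t \notin `[a, c] -> th t = 0]) ->
    \int[mu]_(t in `[0, T]) (q t * th t + p t * th^`()%classic t) = 0.
  move=> sth supp; rewrite -[RHS](weak_euler_lagrange i sth supp).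
  by apply: eq_Rintegral => s; rewrite inE => sT; rewrite /p /q /= clamp_id.
have E (s : R) : s \in `[0, T] -> P s + (p 0 - P 0) = momentum i s.
  move=> sT; rewrite -(du_bois_reymond T_gt0 cp cq dP H (t := s)).
    by rewrite /p /= (clamp_id sT) addrC subrK.
  by move: sT; rewrite in_itv.
apply: (is_tderive_eq tT E).
have t0 : 0 <= t by rewrite (itvP tT).
have := is_tderiveD (is_derive_is_tderive T (dP t t0)) (is_tderive_cst T (p 0 - P 0) t).
by rewrite addr0 /q /= (clamp_id tT).
Qed.

End along_a_path.
End first_variation.

(** * The Onsager-Machlup Lagrangian *)
Section onsager_machlup.
Variables (R : realType) (T : R) (d m : nat).
Local Notation V := 'cV[R]_d.
Local Notation P2 := (P2 R d).
Variables (b : R -> V -> P2 -> V) (sigma : R -> V -> P2 -> 'M[R]_(d, m)).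
Local Notation e_ i := (delta_mx i ord0 : V).
Local Notation S := (Sigma sigma).
Local Notation A := (iSigma sigma).
Local Notation B := (btilde b sigma).
Local Notation O := (OM b sigma).
Implicit Types (x v w z : V) (mu : P2) (t : R).

Lemma dotC x w : dot x w = dot w x.
Proof. by rewrite !dotE; apply: eq_bigr => i _; rewrite mulrC. Qed.

Lemma dotDr x v w : dot x (v + w) = dot x v + dot x w.
Proof. by rewrite /dot mulmxDr mxE. Qed.

Lemma dotNr x w : dot x (- w) = - dot x w.
Proof. by rewrite /dot mulmxN mxE. Qed.

Lemma dotDl x v w : dot (v + w) x = dot v x + dot w x.
Proof. by rewrite !(dotC _ x) dotDr. Qed.

Lemma dotNl x w : dot (- w) x = - dot w x.
Proof. by rewrite !(dotC _ x) dotNr. Qed.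

Lemma dot0l x : dot 0 x = 0.
Proof. by rewrite /dot trmx0 mul0mx mxE. Qed.

Lemma qform_dot (M : 'M[R]_d) x : qform M x = dot x (M *m x).
Proof. by rewrite /qform /dot mulmxA. Qed.

Lemma dot_mulmx_sym (M : 'M[R]_d) x w : M^T = M -> dot x (M *m w) = dot (M *m x) w.
Proof. by move=> MT; rewrite /dot trmx_mul MT mulmxA. Qed.

Lemma dot_delta_mulmx (M : 'M[R]_d) i j : dot (e_ i) (M *m e_ j) = M i j.
Proof.
rewrite dotC dot_delta mxE (bigD1 j)//= !mxE !eqxx mulr1 big1 ?addr0// => k kj.
by rewrite mxE (negbTE kj) mulr0.
Qed.

Lemma iSigma_sym t x mu : (A t x mu)^T = A t x mu.
Proof. by rewrite /iSigma trmx_inv /Sigma trmx_mul trmxK. Qed.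

Lemma Sigma_unit t x mu : Sigma_posdef T sigma -> t \in `[0, T] -> S t x mu \in unitmx.
Proof.
move=> hS tT; rewrite unitmxE unitfE; apply/negP => /det0P[w w0 wS].
have wT0 : w^T != 0 by rewrite -trmx0 (inj_eq (@trmx_inj _ _ _)).
have := hS t x mu tT _ wT0.
by rewrite /qform trmxK wS mul0mx mxE ltxx.
Qed.

Lemma OM_expand t x v mu : O t x v mu =
  2^-1 * dot v (A t x mu *m v) - dot v (A t x mu *m B t x mu) + O t x 0 mu.
Proof.
rewrite /OM !qform_dot sub0r !mulmxN dotNr dotNl opprK mulmxBr.
rewrite dotDr dotNr !dotDl !dotNl (dot_mulmx_sym (B t x mu) v (iSigma_sym t x mu)).
by rewrite (dotC (_ *m B t x mu) v); field.
Qed.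

(** The Hessian in v of a quadratic function, from its values at 0, e_k, e_l and
    e_k + e_l: this is how the regularity of OM reaches the coefficients. *)
Lemma iSigma_polarization t x mu k l :
  A t x mu k l = O t x (e_ k + e_ l) mu - O t x (e_ k) mu - O t x (e_ l) mu + O t x 0 mu.
Proof.
have Akl : A t x mu l k = A t x mu k l by rewrite -[in LHS]iSigma_sym mxE.
rewrite (OM_expand t x (e_ k + e_ l)) (OM_expand t x (e_ k)) (OM_expand t x (e_ l)).
by rewrite mulmxDr !(dotDl, dotDr) !dot_delta_mulmx Akl; field.
Qed.

(** The odd part in v of OM at e_k. *)
Lemma iSigma_btilde_polarization t x mu k :
  (A t x mu *m B t x mu) k ord0 = 2^-1 * (O t x (- e_ k) mu - O t x (e_ k) mu).
Proof.
rewrite (OM_expand t x (e_ k)) (OM_expand t x (- e_ k)).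
by rewrite mulmxN !(dotNr, dotNl) opprK !(dotC (e_ k) (_ *m B t x mu)) dot_delta; field.
Qed.

Hypothesis hB : regularity_B T O.

Lemma OM_opD_defined t v z : t \in `[0, T] -> opD_defined (fun x mu => O t x v mu) z.
Proof.
move=> tT; split; last exact: (B_Ldiff hB z v z tT).
by move=> i; apply: diff_derivable; have [+ _] := B_C1_x hB v (dirac2 z) tT; apply.
Qed.

Let has_opD_opD i (f : V -> P2 -> R) z (u : R) :
  has_opD i f z u -> has_opD i f z (opD f z i ord0).
Proof. by move=> h; rewrite (has_opD_val h). Qed.

Let hasO t v z i : t \in `[0, T] ->
  has_opD i (fun x mu => O t x v mu) z (opD (fun x mu => O t x v mu) z i ord0).
Proof. by move=> tT; apply: opD_defined_has; exact: OM_opD_defined. Qed.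

Lemma opD_iSigma t z i k l : t \in `[0, T] ->
  has_opD i (fun x mu => A t x mu k l) z (D_iSigma sigma t z i k l) /\
  D_iSigma sigma t z i k l =
    opD (fun x mu => O t x (e_ k + e_ l) mu) z i ord0
    - opD (fun x mu => O t x (e_ k) mu) z i ord0
    - opD (fun x mu => O t x (e_ l) mu) z i ord0
    + opD (fun x mu => O t x 0 mu) z i ord0.
Proof.
move=> tT; rewrite mxE.
have h := has_opDD (has_opDB (has_opDB (hasO (e_ k + e_ l) z i tT) (hasO (e_ k) z i tT))
  (hasO (e_ l) z i tT)) (hasO 0 z i tT).
have h' := has_opD_ext (fun x mu => esym (iSigma_polarization t x mu k l)) (erefl _) h.
by split; [exact: has_opD_opD h'|exact: has_opD_val h'].
Qed.

Lemma opD_iSigma_btilde t z i k : t \in `[0, T] ->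
  has_opD i (fun x mu => (A t x mu *m B t x mu) k ord0) z
    (2^-1 * (opD (fun x mu => O t x (- e_ k) mu) z i ord0
             - opD (fun x mu => O t x (e_ k) mu) z i ord0)).
Proof.
move=> tT.
have h := has_opDZ 2^-1 (has_opDB (hasO (- e_ k) z i tT) (hasO (e_ k) z i tT)).
by apply: has_opD_ext h => // x mu; rewrite iSigma_btilde_polarization.
Qed.

Let opD_defined_of (i0 : 'I_d) (f : V -> P2 -> R) z :
  (forall i, exists u, has_opD i f z u) -> opD_defined f z.
Proof.
move=> h; split=> [i|]; first by have [u /has_opD_derivable[]] := h i.
by have [u /has_opD_derivable[]] := h i0.
Qed.

Hypothesis hA : assumption_A T b sigma.
Hypothesis hS : Sigma_posdef T sigma.

Lemma Sigma_iSigma t x mu : t \in `[0, T] -> S t x mu *m A t x mu = 1%:M.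
Proof. by move=> tT; rewrite mulmxV//; exact: Sigma_unit. Qed.

Lemma continuous_Sigma t (X : topologicalType) (y : X) (f : X -> V * P2) j l :
  t \in `[0, T] -> {for y, continuous f} ->
  {for y, continuous (fun p => S t (f p).1 (f p).2 j l)}.
Proof.
move=> tT cf; have [_ cs] := A_continuous hA tT.
have cfs : sigma t (f p).1 (f p).2 @[p --> y] --> sigma t (f y).1 (f y).2.
  exact: (cvg_comp _ _ cf (cs (f y))).
have E p : S t (f p).1 (f p).2 j l =
    \sum_r sigma t (f p).1 (f p).2 j r * sigma t (f p).1 (f p).2 l r.
  by rewrite mxE; apply: eq_bigr => r _; rewrite [in LHS]mxE.
rewrite (_ : (fun p => _) = (fun p =>
  \sum_r sigma t (f p).1 (f p).2 j r * sigma t (f p).1 (f p).2 l r)); last exact/funext.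
by apply: cvg_sum_ord => r; apply: cvgM; exact: cvg_entry.
Qed.

(** The field btilde solves a linear system whose matrix and right-hand side are
    differentiable by polarization, and whose inverse matrix Sigma is
    continuous. *)
Lemma btilde_opD_defined t z k : t \in `[0, T] ->
  opD_defined (fun x mu => B t x mu k ord0) z.
Proof.
move=> tT; apply: (@opD_defined_solve _ _ _ (S t) (A t) (B t)).
- move=> j l; apply: (@continuous_Sigma t _ z (fun x => (x, dirac2 z))) => //.
  exact: (@cvg_pair _ _ _ (nbhs z) (nbhs z) (nbhs (dirac2 z)) _ _ _
    id (fun=> dirac2 z) cvg_id (cvg_cst _)).
- move=> j l; apply: (@continuous_Sigma t _ (dirac2 z) (fun mu => (z, mu))) => //.
  exact: (@cvg_pair _ _ _ (nbhs (dirac2 z)) (nbhs z) (nbhs (dirac2 z)) _ _ _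
    (fun=> z) id (cvg_cst _) cvg_id).
- by move=> x mu; exact: Sigma_iSigma.
- move=> j l; apply: (opD_defined_of j) => i.
  by have [h _] := opD_iSigma z i j l tT; eexists; exact: h.
- move=> j; apply: (opD_defined_of j) => i.
  by eexists; exact: opD_iSigma_btilde.
Qed.

Lemma has_opD_btilde t z i k : t \in `[0, T] ->
  has_opD i (fun x mu => B t x mu k ord0) z (D_btilde b sigma t z k i).
Proof. by move=> tT; rewrite mxE; apply/opD_defined_has/btilde_opD_defined. Qed.

Lemma has_opD_drift t z i k : t \in `[0, T] ->
  has_opD i (fun x mu => (A t x mu *m B t x mu) k ord0) z
   (\sum_l (A t z (dirac2 z) k l * D_btilde b sigma t z l i
            + B t z (dirac2 z) l ord0 * D_iSigma sigma t z i k l)).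
Proof.
move=> tT.
have h := has_opD_sum (fun l => has_opDM (opD_iSigma z i k l tT).1 (has_opD_btilde z i l tT)).
by apply: has_opD_ext h => // x mu; rewrite mxE.
Qed.

Lemma qformE (M : 'M[R]_d) x :
  qform M x = \sum_k \sum_l x k ord0 * (M k l * x l ord0).
Proof.
rewrite qform_dot dotE; apply: eq_bigr => k _.
by rewrite mxE mulr_sumr.
Qed.

(** Product rule for the quadratic form; the two terms where btilde is
    differentiated agree because Sigma^-1 is symmetric. *)
Lemma opD_OM t z v i : t \in `[0, T] ->
  opD_defined (div_btilde b sigma t) z -> opD_defined (Rscal sigma t) z ->
  let w := v - B t z (dirac2 z) in
  opD (fun x mu => O t x v mu) z i ord0 =
    2^-1 * (qform (D_iSigma sigma t z i) w + opD (div_btilde b sigma t) z i ord0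
            - 6^-1 * opD (Rscal sigma t) z i ord0)
    - ((D_btilde b sigma t z)^T *m (A t z (dirac2 z) *m w)) i ord0.
Proof.
move=> tT hdiv hR w.
have hw k : has_opD i (fun x mu => v k ord0 - B t x mu k ord0) z
    (0 - D_btilde b sigma t z k i).
  by apply: has_opDB; [exact: has_opD_cst|exact: has_opD_btilde].
have hq := has_opD_sum (fun k => has_opD_sum (fun l =>
  has_opDM (hw k) (has_opDM (opD_iSigma z i k l tT).1 (hw l)))).
have h := has_opDZ 2^-1 (has_opDB (has_opDD hq (opD_defined_has i hdiv))
  (has_opDZ 6^-1 (opD_defined_has i hR))).
have {hq hw} E := has_opD_val (has_opD_ext (g := fun x mu => O t x v mu) _ (erefl _) h).
rewrite {}E; last first.
  move=> x mu; rewrite /OM qformE; congr (_ * (_ + _ - _)).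
  by apply: eq_bigr => k _; apply: eq_bigr => l _; rewrite !mxE.
pose a := A t z (dirac2 z); pose D := D_btilde b sigma t z.
have wE k : v k ord0 - B t z (dirac2 z) k ord0 = w k ord0 by rewrite !mxE.
have aw k : \sum_l a k l * w l ord0 = (a *m w) k ord0 by rewrite mxE.
have aS k l : a k l = a l k by rewrite /a -[in LHS]iSigma_sym mxE.
have F1 : (D^T *m (a *m w)) i ord0 = \sum_k \sum_l D k i * (a k l * w l ord0).
  by rewrite mxE; apply: eq_bigr => k _; rewrite -mulr_sumr aw mxE.
have F2 : (D^T *m (a *m w)) i ord0 = \sum_k \sum_l w k ord0 * (a k l * D l i).
  rewrite F1 exchange_big /=; apply: eq_bigr => k _; apply: eq_bigr => l _.
  by rewrite (aS l k); ring.
rewrite (_ : \sum_j _ = qform (D_iSigma sigma t z i) w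
  - \sum_k \sum_l D k i * (a k l * w l ord0)
  - \sum_k \sum_l w k ord0 * (a k l * D l i)).
  by rewrite -F1 -F2; field.
rewrite qformE -!sumrB; apply: eq_bigr => k _; rewrite -!sumrB; apply: eq_bigr => l _.
by rewrite !wE -/a -/D; ring.
Qed.

Lemma Lv_OM t x v z i :
  Lv O i (t, x, v, z) = (A t x (dirac2 z) *m (v - B t x (dirac2 z))) i ord0.
Proof.
set nu := dirac2 z; rewrite /Lv /partial /=; apply: derive_val.
apply/is_derive_cvgP; set M := A t x nu.
have E h : h != 0 -> h^-1 *: (O t x (h *: e_ i + v) nu - O t x v nu) =
    (M *m (v - B t x nu)) i ord0 + h * (2^-1 * M i i).
  move=> h0; have sR (y : R) : h^-1 *: y = h^-1 * y by [].
  rewrite {}sR.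
  have D1 y : dot (h *: e_ i) y = h * y i ord0 by rewrite dotC dotZr dot_delta.
  have D2 : dot (h *: e_ i) (M *m (h *: e_ i)) = h * (h * M i i).
    by rewrite -scalemxAr dotZr dotC dotZr dotC dot_delta_mulmx.
  have D3 : dot v (M *m (h *: e_ i)) = h * (M *m v) i ord0.
    by rewrite (dot_mulmx_sym v _ (iSigma_sym t x nu)) dotZr dot_delta.
  rewrite (OM_expand t x (h *: e_ i + v)) (OM_expand t x v) -/M mulmxDr.
  rewrite dotDl dotDr (dotDr v) dotDl D2 D3 D1 D1 (mulmxBr M v).
  have -> (y y' : V) : (y - y') i ord0 = y i ord0 - y' i ord0 by rewrite !mxE.
  by field.
apply: (@cvg_trans _ ((M *m (v - B t x nu)) i ord0 + h * (2^-1 * M i i) @[h --> (0:R)^'])).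
  apply: near_eq_cvg; near=> h; rewrite E//; near: h; exact: nbhs_dnbhs_neq.
set y0 : R := (M *m _) i ord0; set y1 : R := 2^-1 * M i i.
have c : y0 + h * y1 @[h --> (0:R)^'] --> y0 + 0 * y1.
  apply: cvgD; first exact: cvg_cst.
  by apply: cvgM; [exact: nbhs_dnbhs|exact: cvg_cst].
by rewrite mul0r addr0 in c.
Unshelve. all: by end_near. Qed.

Lemma Lx_Lmu_OM t z v i :
  Lx O i (t, z, v, z) + Lmu O i (t, z, v, z) = opD (fun x mu => O t x v mu) z i ord0.
Proof. by rewrite /opD !mxE. Qed.

(** * The equation of the critical path *)
Section critical_path.
Hypothesis T_gt0 : 0 < T.
Variable phi : R -> V.
Hypothesis hphi : C2_path T phi.
Hypothesis hcrit : critical_point T O phi.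
Local Notation psi := (mtderive T phi).
Local Notation dl t := (dirac2 (phi t)).

Let is_tderive_ext (f g : R -> R) t (a c : R) : (forall s, f s = g s) -> a = c ->
  is_tderive T f t a -> is_tderive T g t c.
Proof. by move=> /funext -> ->. Qed.

Let difference4 (x1 x2 x3 x4 y1 y2 y3 y4 x y : R) :
  x = x1 - x2 - x3 + x4 -> y = y1 - y2 - y3 + y4 ->
  x1 - y1 + -1 * (x2 - y2) + -1 * (x3 - y3) + (x4 - y4) = x - y.
Proof. by move=> -> ->; ring. Qed.

Let sum4 (x1 x2 x3 x4 p : R) :
  x1 * p + -1 * (x2 * p) + -1 * (x3 * p) + x4 * p = (x1 - x2 - x3 + x4) * p.
Proof. by ring. Qed.

Let difference2 (x1 x2 y1 y2 x y : R) :
  x = 2^-1 * (x1 - x2) -> y = 2^-1 * (y1 - y2) ->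
  2^-1 * (x1 - y1 + -1 * (x2 - y2)) = x - y.
Proof. by move=> -> ->; ring. Qed.

Let sum2 (x1 x2 p : R) : 2^-1 * (x1 * p) + 2^-1 * (-1 * (x2 * p)) = 2^-1 * (x1 - x2) * p.
Proof. by ring. Qed.

Lemma tderive_OM_increment v t : t \in `[0, T] ->
  is_tderive T (fun s => O s (phi s) v (dl s) - O s (phi t) v (dl t)) t
    (\sum_i opD (fun x mu => O t x v mu) (phi t) i ord0 * psi t i ord0).
Proof.
move=> tT; have := @path_increment _ _ _ _ T_gt0 hB _ hphi v t tT; apply: is_tderive_ext => //.
by apply: eq_bigr => i _; rewrite Lx_Lmu_OM.
Qed.

Lemma tderive_iSigma_increment t k l : t \in `[0, T] ->
  is_tderive T (fun s => A s (phi s) (dl s) k l - A s (phi t) (dl t) k l) t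
    (\sum_i D_iSigma sigma t (phi t) i k l * psi t i ord0).
Proof.
move=> tT; have H v := @tderive_OM_increment v t tT.
have := is_tderiveD (is_tderiveD (is_tderiveD (H (e_ k + e_ l))
  (is_tderiveZ (c := -1) (H (e_ k)))) (is_tderiveZ (c := -1) (H (e_ l)))) (H 0).
apply: is_tderive_ext => [s|]; first exact: (difference4
  (iSigma_polarization s (phi s) (dl s) k l) (iSigma_polarization s (phi t) (dl t) k l)).
rewrite !mulr_sumr -!big_split /=; apply: eq_bigr => i _.
rewrite (opD_iSigma (phi t) i k l tT).2.
exact: sum4.
Qed.

Lemma tderive_drift_increment t k : t \in `[0, T] ->
  is_tderive T (fun s => (A s (phi s) (dl s) *m B s (phi s) (dl s)) k ord0
                         - (A s (phi t) (dl t) *m B s (phi t) (dl t)) k ord0) t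
    (\sum_i (\sum_l (A t (phi t) (dl t) k l * D_btilde b sigma t (phi t) l i
       + B t (phi t) (dl t) l ord0 * D_iSigma sigma t (phi t) i k l)) * psi t i ord0).
Proof.
move=> tT; have H v := @tderive_OM_increment v t tT.
have := is_tderiveZ (c := 2^-1) (is_tderiveD (H (- e_ k)) (is_tderiveZ (c := -1) (H (e_ k)))).
apply: is_tderive_ext => [s|].
  exact: (difference2 (iSigma_btilde_polarization s (phi s) (dl s) k)
    (iSigma_btilde_polarization s (phi t) (dl t) k)).
rewrite mulrDr !mulr_sumr -!big_split /=; apply: eq_bigr => i _.
rewrite -(has_opD_val (has_opD_drift (phi t) i k tT)).
rewrite (has_opD_val (opD_iSigma_btilde (phi t) i k tT)).
exact: sum2.
Qed.

Lemma momentum_OM i s :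
  momentum T O phi i s = \sum_l A s (phi s) (dl s) i l * psi s l ord0
    - (A s (phi s) (dl s) *m B s (phi s) (dl s)) i ord0.
Proof. by rewrite /momentum Lv_OM mulmxBr !mxE. Qed.

(** Each coefficient of the momentum varies along the path by its variation in
    time at the frozen point plus the increment given by the chain rule. *)
Lemma tderive_momentum t i : t \in `[0, T] ->
  let z := phi t in let mu := dirac2 z in
  mtderivable T (fun s => B s z mu) t -> mtderivable T (fun s => A s z mu) t ->
  is_tderive T (momentum T O phi i) t
    ((A t z mu *m mtderive T psi t
      + (mtderive T (fun s => A s z mu) t
         + \sum_(j < d) psi t j ord0 *: D_iSigma sigma t z j) *m (psi t - B t z mu)
      - A t z mu *m mtderive T (fun s => B s z mu) t
      - A t z mu *m (D_btilde b sigma t z *m psi t)) i ord0).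
Proof.
move=> tT z mu dB dA.
have hA' k l : is_tderive T (fun s => A s (phi s) (dl s) k l) t
   (mtderive T (fun s => A s z mu) t k l
    + \sum_j D_iSigma sigma t z j k l * psi t j ord0).
  have h0 : is_tderive T (fun s => A s z mu k l) t (mtderive T (fun s => A s z mu) t k l).
    by rewrite mxE; exact: dA.
  have := is_tderiveD h0 (@tderive_iSigma_increment t k l tT); apply: is_tderive_ext => // s.
  by rewrite addrC subrK.
have hc : is_tderive T (fun s => (A s (phi s) (dl s) *m B s (phi s) (dl s)) i ord0) t
  ((mtderive T (fun s => A s z mu) t *m B t z mu
    + A t z mu *m mtderive T (fun s => B s z mu) t) i ord0
   + \sum_j (\sum_l (A t z mu i l * D_btilde b sigma t z l j
       + B t z mu l ord0 * D_iSigma sigma t z j i l)) * psi t j ord0).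
  have h0 : is_tderive T (fun s => (A s z mu *m B s z mu) i ord0) t
    ((mtderive T (fun s => A s z mu) t *m B t z mu
    + A t z mu *m mtderive T (fun s => B s z mu) t) i ord0).
    have hl l := is_tderiveM (dA i l : is_tderive T _ t _) (dB l ord0 : is_tderive T _ t _).
    have := is_tderive_sum hl; apply: is_tderive_ext => [s|]; first by rewrite mxE.
    rewrite big_split /= addrC [RHS]mxE [X in _ = X + _]mxE [X in _ = _ + X]mxE.
    congr (_ + _); apply: eq_bigr => l _.
      by rewrite [X in _ = X * _]mxE mulrC.
    by rewrite [X in _ = _ * X]mxE.
  have := is_tderiveD h0 (@tderive_drift_increment t i tT); apply: is_tderive_ext => // s.
  by rewrite addrC subrK.
have hv l := is_tderiveM (hA' i l) (@is_tderive_velocity _ _ _ _ hphi l t tT).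
have := is_tderiveD (is_tderive_sum hv) (is_tderiveZ (c := -1) hc); apply: is_tderive_ext => [s|].
  by rewrite momentum_OM mulN1r.
set DA := fun j => D_iSigma sigma t z j; set DB := D_btilde b sigma t z.
set dtA := mtderive T (fun s => A s z mu) t; set dtB := mtderive T (fun s => B s z mu) t.
set acc := mtderive T psi t; set v := psi t.
have sE (M N : V) : (M + N) i ord0 = M i ord0 + N i ord0 by rewrite mxE.
have nE (M : V) : (- M) i ord0 = - M i ord0 by rewrite mxE.
rewrite !sE !nE big_split /= mulN1r mulmxBr !mulmxDl !sE nE sE.
have E1 : \sum_l A t z mu i l * acc l ord0 = (A t z mu *m acc) i ord0 by rewrite mxE.
have E2 : \sum_l v l ord0 * (dtA i l + \sum_j DA j i l * v j ord0) =
   (dtA *m v) i ord0 + ((\sum_j v j ord0 *: DA j) *m v) i ord0.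
  rewrite !mxE -big_split /=; apply: eq_bigr => l _; rewrite summxE mulrC mulrDl.
  by congr (_ + _ * _); apply: eq_bigr => j _; rewrite [RHS]mxE mulrC.
have E3 : \sum_j (\sum_l (A t z mu i l * DB l j + B t z mu l ord0 * DA j i l)) * v j ord0 =
   (A t z mu *m (DB *m v)) i ord0 + ((\sum_j v j ord0 *: DA j) *m B t z mu) i ord0.
  under eq_bigr do rewrite big_split mulrDl /=.
  rewrite big_split /=; congr (_ + _).
    by rewrite mulmxA mxE; apply: eq_bigr => j _; rewrite [in RHS]mxE.
  under eq_bigr do rewrite mulr_suml.
  rewrite exchange_big mxE /=; apply: eq_bigr => l _; rewrite summxE mulr_suml.
  by apply: eq_bigr => j _; rewrite [in RHS]mxE; ring.
by rewrite E1 E2 E3; ring.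
Qed.

(** The Euler-Lagrange equation multiplied by Sigma. *)
Lemma solve_acceleration (s a DB dA : 'M[R]_d) (acc v w B0 dtB F : V) :
  s *m a = 1%:M -> w = v - B0 ->
  a *m acc + dA *m w - a *m dtB - a *m (DB *m v) =
    2^-1 *: F - DB^T *m (a *m w) ->
  acc = dtB + s *m DB^T *m a *m B0 + (DB - s *m DB^T *m a) *m v + 2^-1 *: (s *m F)
        - s *m dA *m w.
Proof.
move=> sa wE E; have {E} := congr1 (mulmx s) E.
rewrite !mulmxBr mulmxDr !mulmxA sa !mul1mx -scalemxAr mulmxBl.
have -> : s *m DB^T *m a *m w = s *m DB^T *m a *m v - s *m DB^T *m a *m B0.
  by rewrite wE mulmxBr.
move: (s *m dA *m w) (s *m F) (_ *m v) (DB *m v) (_ *m B0) => Y H Gv Z GB E.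
apply/matrixP => i j; have := congr1 (fun M : V => M i j) E; rewrite !mxE; lra.
Qed.

Theorem critical_path_equation t : t \in `[0, T] -> rhs_defined T b sigma t (phi t) ->
  mtderive T psi t = EL_rhs T b sigma t (phi t) (psi t).
Proof.
move=> tT [dB dA hdiv hR].
pose z := phi t; pose mu := dirac2 z; pose v := psi t; pose w := v - B t z mu.
pose DB := D_btilde b sigma t z; pose a := A t z mu; pose s := S t z mu.
pose dtB := mtderive T (fun s => B s z mu) t.
pose dA' := mtderive T (fun s => A s z mu) t
            + \sum_(j < d) v j ord0 *: D_iSigma sigma t z j.
pose F := \col_i qform (D_iSigma sigma t z i) w + opD (div_btilde b sigma t) z
          - 6^-1 *: opD (Rscal sigma t) z.
have E : a *m mtderive T psi t + dA' *m w - a *m dtB - a *m (DB *m v) =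
         2^-1 *: F - DB^T *m (a *m w).
  apply/matrixP => i j; rewrite [j]ord1.
  have h1 := @tderive_momentum t i tT dB dA.
  have h2 := @euler_lagrange _ _ _ _ T_gt0 hB _ hphi hcrit i t tT.
  rewrite -(is_tderive_tderive T_gt0 tT h1) (is_tderive_tderive T_gt0 tT h2).
  rewrite /force /= Lx_Lmu_OM (opD_OM (psi t) i tT hdiv hR) -/z -/mu -/w -/a -/DB.
  by rewrite [RHS]mxE [X in _ = X + _]mxE [X in _ = _ + X]mxE /F !mxE.
have sa : s *m a = 1%:M by exact: Sigma_iSigma.
exact: (solve_acceleration sa (erefl w) E).
Qed.

(** * Constant diffusion in dimension one *)
Section constant_diffusion.
Variable s : 'M[R]_(d, m).
Hypothesis dim1 : forall i j : 'I_d, i = j.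
Hypothesis sigmaE : forall t x mu, t \in `[0, T] -> sigma t x mu = s.
Let sigma2 := sqfrob s.

Let sum1 (F : 'I_d -> R) i : \sum_j F j = F i.
Proof. by rewrite (bigD1 i)//= big1 ?addr0// => j; rewrite (dim1 j i) eqxx. Qed.

Lemma Sigma_const t x mu : t \in `[0, T] -> S t x mu = sigma2%:M.
Proof.
move=> tT; rewrite /Sigma sigmaE//; apply/matrixP => i j.
by rewrite (dim1 j i) [RHS]mxE eqxx /sigma2 /sqfrob /mxtrace (sum1 _ i).
Qed.

Lemma sigma2_gt0 (i : 'I_d) : 0 < sigma2.
Proof.
have T0 : (0 : R) \in `[0, T] by rewrite in_itv/= lexx ltW.
have ei0 : e_ i != 0.
  apply/eqP => /matrixP/(_ i ord0); rewrite !mxE !eqxx => /eqP.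
  by rewrite oner_eq0.
have := hS 0 (dirac2 0) T0 ei0.
by rewrite qform_dot dot_delta_mulmx Sigma_const// mxE eqxx.
Qed.

Lemma iSigma_const t x mu : t \in `[0, T] -> A t x mu = sigma2^-1%:M.
Proof. by move=> tT; rewrite /iSigma Sigma_const// invmx_scalar. Qed.

Let partial_cst (c : R) i x : partial i (fun=> c) x = 0.
Proof. exact: derive_cst. Qed.

Let metric_cst t mu : t \in `[0, T] -> (fun y => A t y mu) = fun=> sigma2^-1%:M.
Proof. by move=> tT; apply/funext => y; exact: iSigma_const. Qed.

Lemma christoffel_cst (M : 'M[R]_d) i l j : christoffel (fun=> M) i l j = fun=> 0.
Proof.
apply/funext => x; rewrite /christoffel big1 ?mulr0// => r _.
by rewrite !partial_cst addr0 subr0 mulr0.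
Qed.

Lemma scalar_curvature_cst (M : 'M[R]_d) x : scalar_curvature (fun=> M) x = 0.
Proof.
rewrite /scalar_curvature big1// => l _; rewrite big1// => j _.
rewrite /ricci big1 ?mulr0// => i _; rewrite !christoffel_cst !partial_cst subr0 add0r.
by rewrite big1// => r _; rewrite !christoffel_cst !mul0r subr0.
Qed.

Lemma Rscal_const t x mu : t \in `[0, T] -> Rscal sigma t x mu = 0.
Proof. by move=> tT; rewrite /Rscal metric_cst// scalar_curvature_cst. Qed.

Lemma btilde_const t x mu : t \in `[0, T] -> B t x mu = b t x mu.
Proof.
move=> tT; apply/matrixP => i j; rewrite mxE [j]ord1 metric_cst//.
rewrite big1 ?mulr0 ?subr0// => l _; rewrite big1// => k _.
by rewrite christoffel_cst mulr0.
Qed.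

Lemma btilde_OM t x mu i : t \in `[0, T] ->
  B t x mu i ord0 = sigma2 * (2^-1 * (O t x (- e_ i) mu - O t x (e_ i) mu)).
Proof.
move=> tT; rewrite -iSigma_btilde_polarization iSigma_const// mul_scalar_mx [in RHS]mxE.
by rewrite mulVKf// gt_eqF// sigma2_gt0.
Qed.

Lemma derivable_btilde t x mu i : t \in `[0, T] ->
  derivable (fun y => B t y mu i ord0) x (e_ i).
Proof.
move=> tT; rewrite (_ : (fun y => _) = (fun y =>
    sigma2 * (2^-1 * (O t y (- e_ i) mu - O t y (e_ i) mu)))); last first.
  by apply/funext => y; exact: btilde_OM.
have dO v : derivable (fun y => O t y v mu) x (e_ i).
  by apply: diff_derivable; have [+ _] := B_C1_x hB v mu tT; apply.
by do 2! apply: derivableZ; apply: derivableB; exact: dO.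
Qed.

(** The density sqrt (det g) is a nonzero constant and cancels. *)
Lemma div_btilde_const t x mu i : t \in `[0, T] ->
  div_btilde b sigma t x mu = partial i (fun y => b t y mu i ord0) x.
Proof.
move=> tT; rewrite /div_btilde metric_cst// /divergence (sum1 _ i).
set c := Num.sqrt _.
have c0 : c != 0.
  rewrite /c gt_eqF// sqrtr_gt0 det_scalar exprn_gt0// invr_gt0.
  exact: sigma2_gt0 i.
have -> : (fun y => b t y mu i ord0) = (fun y => B t y mu i ord0).
  by apply/funext => y; rewrite btilde_const.
rewrite (_ : (fun y => B t y mu i ord0 * c) = c \*: (fun y => B t y mu i ord0)).
  rewrite /partial deriveZ; last exact: derivable_btilde.
  by rewrite -[c *: _]/(c * _) mulKf.
by apply/funext => y; rewrite mulrC.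
Qed.

(** As R = 0, div btilde is twice OM at v = 0 minus the quadratic term. *)
Lemma opD_defined_div t z (i : 'I_d) : t \in `[0, T] -> opD_defined (div_btilde b sigma t) z.
Proof.
move=> tT; apply: (opD_defined_of i) => j.
have h0 := has_opDZ 2 (opD_defined_has j (OM_opD_defined 0 z tT)).
have hq := has_opD_sum (fun k => has_opDM (has_opD_btilde z j k tT) (has_opD_drift z j k tT)).
eexists; apply: has_opD_ext (has_opDB h0 hq) => // x mu.
rewrite /OM qform_dot sub0r mulmxN dotNr dotNl opprK dotE Rscal_const// mulr0 subr0.
by field.
Qed.

Lemma drift_const t x mu k : t \in `[0, T] ->
  (A t x mu *m B t x mu) k ord0 = sigma2^-1 * B t x mu k ord0.
Proof. by move=> tT; rewrite iSigma_const// mul_scalar_mx [LHS]mxE. Qed.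

(** Here the derivative in t of b is a consequence of the Euler-Lagrange
    equation.  On [0, T] the value of btilde at the frozen point is an affine
    combination of the velocity, the momentum and the increment of
    Sigma^-1 btilde along the path, all three of which are differentiable. *)
Lemma tderivable_btilde t k : t \in `[0, T] ->
  tderivable T (fun r => B r (phi t) (dl t) k ord0) t.
Proof.
move=> tT.
have hmom := @euler_lagrange _ _ _ _ T_gt0 hB _ hphi hcrit k t tT.
have hinc := @tderive_drift_increment t k tT.
have hvel := @is_tderive_velocity _ _ _ _ hphi k t tT.
have := is_tderiveZ (c := sigma2) (is_tderiveD (is_tderiveZ (c := sigma2^-1) hvel)
  (is_tderiveZ (c := -1) (is_tderiveD hmom hinc))).
move=> h; apply: is_tderive_tderivable; apply: (is_tderive_eq tT _ h) => r rT.
have solve (a v p cr ct y : R) : a = sigma2^-1 -> p = a * v - cr ->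
    ct = sigma2^-1 * y -> sigma2 * (sigma2^-1 * v + -1 * (p + (cr - ct))) = y.
  by move=> -> -> ->; field; rewrite gt_eqF// (sigma2_gt0 k).
apply: (solve (A r (phi r) (dl r) k k)).
- by rewrite iSigma_const// mxE eqxx.
- by rewrite momentum_OM (sum1 _ k).
- exact: drift_const.
Qed.

Let is_tderive_iSigma t k l : t \in `[0, T] ->
  is_tderive T (fun r => A r (phi t) (dl t) k l) t 0.
Proof.
move=> tT; apply: (is_tderive_eq tT _ (is_tderive_cst T ((sigma2^-1%:M : 'M[R]_d) k l) t)).
by move=> r rT; rewrite iSigma_const.
Qed.

Lemma opD_defined_cst (c : R) z : opD_defined (fun _ _ => c) z.
Proof.
split=> [i|]; first exact: derivable_cst.
by exists (cst 0); apply: Lexpands_is_Lderive; exact: Lexpands_cst.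
Qed.

Lemma rhs_defined_const t (i : 'I_d) : t \in `[0, T] -> rhs_defined T b sigma t (phi t).
Proof.
move=> tT; split.
- by move=> k l; rewrite [l]ord1; exact: tderivable_btilde.
- by move=> k l; apply: is_tderive_tderivable (is_tderive_iSigma k l tT).
- exact: opD_defined_div i tT.
- rewrite (_ : Rscal sigma t = fun _ _ => 0); first exact: opD_defined_cst.
  by apply/funext => x; apply/funext => mu; exact: Rscal_const.
Qed.

Let EL_rhs_entry (c : R) (DB : 'M[R]_d) (dB bt v w G : V) i : c != 0 ->
  (dB + c%:M *m DB^T *m c^-1%:M *m bt + (DB - c%:M *m DB^T *m c^-1%:M) *m v
   + 2^-1 *: (c%:M *m (0 + G - 6^-1 *: 0)) - c%:M *m 0 *m w) i ord0
  = dB i ord0 + bt i ord0 * DB i i + c / 2 * G i ord0.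
Proof.
move=> c0.
have -> : c%:M *m DB^T *m c^-1%:M = DB.
  rewrite mul_scalar_mx mul_mx_scalar scalerA mulVf// scale1r.
  by apply/matrixP => k l; rewrite mxE (dim1 k l).
rewrite subrr mul0mx scaler0 subr0 add0r addr0 mulmx0 mul0mx subr0 mul_scalar_mx.
have dE (x y : V) : (x + y) i ord0 = x i ord0 + y i ord0 by rewrite mxE.
have sE (k : R) (x : V) : (k *: x) i ord0 = k * x i ord0 by rewrite mxE.
by rewrite !dE !sE mxE (sum1 _ i); ring.
Qed.

Lemma critical_path_equation_const t i : t \in `[0, T] ->
  mtderive T psi t i ord0 =
    tderive T (fun r => b r (phi t) (dl t) i ord0) t
    + b t (phi t) (dl t) i ord0 * opD (fun x mu => b t x mu i ord0) (phi t) i ord0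
    + sigma2 / 2 * opD (fun x mu => partial i (fun y => b t y mu i ord0) x) (phi t) i ord0.
Proof.
move=> tT; rewrite (critical_path_equation tT (rhs_defined_const i tT)).
rewrite /EL_rhs Sigma_const// iSigma_const//.
have -> : mtderive T (fun r => A r (phi t) (dl t)) t = 0.
  apply/matrixP => k l; rewrite !mxE.
  exact: is_tderive_tderive (is_tderive_iSigma k l tT).
have D0 j : D_iSigma sigma t (phi t) j = 0.
  apply/matrixP => k l; rewrite [LHS]mxE [RHS]mxE; apply: has_opD_val.
  apply: has_opD_ext (has_opD_cst j ((sigma2^-1%:M : 'M[R]_d) k l) (phi t)) => // x mu.
  by rewrite iSigma_const.
have -> : \sum_(j < d) psi t j ord0 *: D_iSigma sigma t (phi t) j = 0.
  by rewrite big1// => j _; rewrite D0 scaler0.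
rewrite addr0.
have -> : \col_j qform (D_iSigma sigma t (phi t) j) (psi t - B t (phi t) (dl t)) = 0.
  by apply/matrixP => k l; rewrite !mxE D0 qform_dot mul0mx dotC dot0l.
have -> : opD (Rscal sigma t) (phi t) = 0.
  apply/matrixP => k l; rewrite [l]ord1 [RHS]mxE; apply: has_opD_val.
  apply: has_opD_ext (has_opD_cst k 0 (phi t)) => // x mu.
  by rewrite Rscal_const.
have bE : (fun x mu => B t x mu i ord0) = (fun x mu => b t x mu i ord0).
  by apply/funext => x; apply/funext => mu; rewrite btilde_const.
have divE : div_btilde b sigma t = (fun x mu => partial i (fun y => b t y mu i ord0) x).
  by apply/funext => x; apply/funext => mu; exact: div_btilde_const.
rewrite EL_rhs_entry ?gt_eqF ?(sigma2_gt0 i)// divE btilde_const// [D_btilde _ _ _ _ i i]mxE bE.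
congr (_ + _ + _); rewrite mxE; apply/esym; apply: is_tderive_tderive => //.
have h := tderivableP (@tderivable_btilde t i tT).
by apply: (is_tderive_eq tT _ h) => r rT; rewrite btilde_const.
Qed.

End constant_diffusion.
End critical_path.
End onsager_machlup.

Theorem theorem3p5 (R : realType) (T : R) (d m : nat)
  (b : R -> 'cV[R]_d -> P2 R d -> 'cV[R]_d)
  (sigma : R -> 'cV[R]_d -> P2 R d -> 'M[R]_(d, m))
  (z0 zT : 'cV[R]_d) (phi : R -> 'cV[R]_d)
  (T_gt0 : 0 < T)
  (hA : assumption_A T b sigma)
  (hSigma : Sigma_posdef T sigma)
  (hB : regularity_B T (OM b sigma))
  (hphi : C2_path T phi)
  (hcrit : critical_point T (OM b sigma) phi)
  (hphi0 : phi 0 = z0) (hphiT : phi T = zT) :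
  ((forall t, t \in `[0, T] -> rhs_defined T b sigma t (phi t)) ->
   forall t, t \in `[0, T] ->
     mtderive T (mtderive T phi) t
     = EL_rhs T b sigma t (phi t) (mtderive T phi t))
  /\
  (d = 1%N ->
   forall s : 'M[R]_(d, m),
   (forall t x mu, t \in `[0, T] -> sigma t x mu = s) ->
   let sigma2 := sqfrob s in
   (forall t x mu, t \in `[0, T] ->
      [/\ btilde b sigma t x mu = b t x mu,
          Sigma sigma t x mu = sigma2%:M &
          Rscal sigma t x mu = 0]) /\
   forall (i : 'I_d) t, t \in `[0, T] ->
     let b1 := fun s x mu => b s x mu i ord0 in
     let dxb := fun s x mu => partial i (fun y => b1 s y mu) x in
     let z := phi t in
     let mu := dirac2 z in
     mtderive T (mtderive T phi) t i ord0
       = tderive T (fun s => b1 s z mu) t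
         + b1 t z mu * opD (b1 t) z i ord0
         + sigma2 / 2 * opD (dxb t) z i ord0
     /\
     mtderive T (mtderive T phi) t i ord0
       = tderive T (fun s => b1 s z mu) t
         + b1 t z mu * dxb t z mu
         + b1 t z mu * Lderive (b1 t z) z i ord0
         + sigma2 / 2 * partial i (fun x => dxb t x mu) z
         + sigma2 / 2 * Lderive (dxb t z) z i ord0).
Proof.
split=> [hrhs t tT|d1 s sigmaE sigma2].
  exact: (critical_path_equation hB hA hSigma T_gt0 hphi hcrit tT (hrhs t tT)).
have dim1 (i j : 'I_d) : i = j.
  have ord_eq0 (k : 'I_d) : k = 0%N :> nat.
    by apply/eqP; rewrite -leqn0 -ltnS -d1.
  by apply: val_inj; rewrite /= !ord_eq0.
split=> [t x mu tT|i t tT b1 dxb z mu].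
  by split; [exact: btilde_const sigmaE _ _ _ tT|
    exact: Sigma_const dim1 sigmaE _ _ _ tT|exact: Rscal_const sigmaE _ _ _ tT].
have E : mtderive T (mtderive T phi) t i ord0 = tderive T (fun s => b1 s z mu) t
    + b1 t z mu * opD (b1 t) z i ord0 + sigma2 / 2 * opD (dxb t) z i ord0.
  exact: (critical_path_equation_const hB hA hSigma T_gt0 hphi hcrit dim1 sigmaE i tT).
split=> //; rewrite E /opD.
have sE (x y : 'cV[R]_d) : (x + y) i ord0 = x i ord0 + y i ord0 by rewrite mxE.
have gE (f : 'cV[R]_d -> R) x : grad f x i ord0 = partial i f x by rewrite mxE.
by rewrite !sE !gE !mulrDr !addrA.
Qed.
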